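(* Let $\mathcal G$ be a Farey-indexed real Markov topograph with labels in $(-\infty,-2)\cup(2,\infty)$ and discriminator $D\ne4$, and let $M_{\mathcal G}(X)=\#\{q\in\mathbb P^1(\mathbb Q): |m^*_q|\le X\}$. Then, as $X\to\infty$, $$M_{\mathcal G}(X)=\frac{3\,\mathrm{Area}(\mathcal B(\mathcal G))}{\pi^2}(\log X)^2+O\left(\log X\,\log\log X\right).$$
   Context: A real Markov topograph $\mathcal G$ is an infinite 3-regular tree drawn in the plane, with a real label on every complementary region, such that for every edge, with regions $s,t$ on its two sides and regions $r,u$ at its two ends, $r+u=st$. The discriminator is $D=r^2+s^2+t^2-rst$ for the three labels $r,s,t$ meeting at a vertex (independent of the vertex). Sign variants: the regions of $\mathcal G$ have a 3-colouring (unique up to permuting colours) in which adjacent regions have different colours; a sign variant of $\mathcal G$ is obtained by picking two colours and changing the signs of all labels of regions with those colours. A negative vertex well is a vertex whose three neighbouring regions all have labels $\le-2$. Farey indexing: regions are indexed by $\mathbb P^1(\mathbb Q)$, with elements written $k/n$ for $\gcd(k,n)=1$, $k/n=(-k)/(-n)$, including $1/0$. One chooses a vertex whose three regions, in clockwise order, are $(s,u,t)$ and sets $m^*_{1/0}=s$, $m^*_{1/1}=u$, $m^*_{0/1}=t$; the indexing extends uniquely by the rule that if $k/n$ and $k'/n'$ index the two regions on the sides of an edge then the regions at its ends have indices $(k+k')/(n+n')$ and $(k-k')/(n-n')$; $m^*_{k/n}$ denotes the label of region $k/n$. If $\mathcal G$ or a sign variant of it has a negative vertex well $v$, the Farey indexing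 is always chosen so that $v$ is the vertex where the regions $1/0,1/1,0/1$ meet. Let $\rho(x)=\cosh^{-1}(x/2)$ for $x\ge2$ and $$P_{\mathcal G}=\left\{\left(\frac n{\rho(|m^*_{k/n}|)},\frac k{\rho(|m^*_{k/n}|)}\right): k,n\in\mathbb Z,\ \gcd(k,n)=1\right\}.$$ For $\mathcal G$ as in the statement, $P_{\mathcal G}$ extends uniquely to a continuous closed polar curve $\Gamma_{\mathcal G}=\{R(\theta)(\cos\theta,\sin\theta)\}$ about the origin, with $R$ continuous, positive and finite; $\mathcal B(\mathcal G)=\{r(\cos\theta,\sin\theta):0\le r\le R(\theta)\}$ is the compact ball it encloses. *)

(* Defs.v *)
From HB Require Import structures.
From Stdlib Require Import Relation_Operators.
From mathcomp Require Import all_boot all_order all_algebra.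
From mathcomp Require Import all_classical all_reals all_analysis.
From mathcomp Require Import finmap ring lra.

Set Implicit Arguments.
Unset Strict Implicit.
Unset Printing Implicit Defensive.

Import Order.TTheory GRing.Theory Num.Theory.
Import numFieldNormedType.Exports.
Local Open Scope classical_set_scope.
Local Open Scope ring_scope.

(* A 3-regular tree drawn in the plane, encoded as a combinatorial map.  A dart
   is an edge with a choice of one of its two ends (its origin), [opp] exchanges
   the two ends, and [rot] turns clockwise to the next dart with the same origin.
   [left d] is the complementary region on the left of [d] when it is traversed
   from its origin.  Hence the regions around the origin of [d] are, clockwise,
   [left d], [left (rot d)] and [left (rot (rot d))]; the regions on the two
   sides of the edge of [d] are [left d] and [left (opp d)], and the regions at
   its two ends are [left (rot (rot d))] and [left (rot (rot (opp d)))].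
   Following the boundary of a region with the region on the left leads from [d]
   to [rot (opp d)].  A step from [d] to [rot (opp d)] or [rot (rot (opp d))] is
   a step of a walk without backtracking, so [map_acyclic] excludes circuits
   (loops and multiple edges included). *)
Record plane_cubic_tree := PlaneCubicTree {
  dart : Type;
  opp : dart -> dart;
  rot : dart -> dart;
  region : Type;
  left : dart -> region;
  dart_inhabited : inhabited dart;
  oppK : forall d, opp (opp d) = d;
  opp_neq : forall d, opp d <> d;
  rotK : forall d, rot (rot (rot d)) = d;
  rot_neq : forall d, rot d <> d;
  map_connected : forall d e,
    clos_refl_trans dart (fun x y => y = opp x \/ y = rot x) d e;
  map_acyclic : forall d,
    ~ clos_trans dart
        (fun x y => y = rot (opp x) \/ y = rot (rot (opp x))) d d;
  left_surj : forall r, exists d, left d = r;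
  left_eqP : forall d e, left d = left e <->
    clos_refl_sym_trans dart (fun x y => y = rot (opp x)) d e
}.

Arguments opp {p} _.
Arguments rot {p} _.
Arguments left {p} _.

Record markov_topograph (R : realType) := MarkovTopograph {
  tree :> plane_cubic_tree;
  label : region tree -> R;
  edge_rule : forall d : dart tree,
    label (left (rot (rot d))) + label (left (rot (rot (opp d))))
    = label (left d) * label (left (opp d))
}.

Arguments label {R} _ _.

Definition vertex_discriminator (R : realType) (G : markov_topograph R)
    (d : dart G) : R :=
  let r := label G (left d) in
  let s := label G (left (rot d)) in
  let t := label G (left (rot (rot d))) in
  r ^+ 2 + s ^+ 2 + t ^+ 2 - r * s * t.

Definition has_discriminator (R : realType) (G : markov_topograph R) (D : R) :=
  forall d : dart G, vertex_discriminator d = D.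

Lemma vertex_discriminator_const (R : realType) (G : markov_topograph R)
    (d e : dart G) : vertex_discriminator d = vertex_discriminator e.
Proof.
elim: (map_connected d e) => {d e} [d e [->|->]|//|d e f _ -> _ ->//].
- rewrite /vertex_discriminator.
  have E : forall x : dart G, left (rot (opp x)) = left x.
    move=> x; apply/left_eqP; apply: rst_sym; exact: rst_step.
  have E2 : left (rot d) = left (opp d) by rewrite -[in LHS](oppK d) E.
  rewrite E E2.
  have /(canRL (addrK _)) -> := edge_rule d.
  ring.
- by rewrite /vertex_discriminator rotK; ring.
Qed.

Definition proper_colouring (T : plane_cubic_tree) (c : region T -> 'I_3) :=
  forall d : dart T, c (left d) != c (left (opp d)).

Definition sign_variant (R : realType) (T : plane_cubic_tree)
    (l l' : region T -> R) :=
  exists c : region T -> 'I_3, proper_colouring c /\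
  exists i j : 'I_3, i != j /\
    forall r, l' r = if (c r == i) || (c r == j) then - l r else l r.

Definition negative_vertex_well (R : realType) (T : plane_cubic_tree)
    (l : region T -> R) (d : dart T) :=
  [/\ l (left d) <= - 2, l (left (rot d)) <= - 2
    & l (left (rot (rot d))) <= - 2].

(* The projective line over the rationals; [None] is the point 1/0. *)
Definition P1Q := option rat.

Definition frac (k n : int) : P1Q :=
  if n == 0 then None else Some (k%:Q / n%:Q).

(* [reg q] is the region of index [q], and the chosen vertex is the origin of
   [base].  In [reg_rule] the two ends are not ordered, since replacing (k', n')
   by (- k', - n') exchanges the two fractions. *)
Record farey_indexing (R : realType) (G : markov_topograph R) := FareyIndexing {
  reg : P1Q -> region G;
  base : dart G;
  reg_bij : bijective reg;
  reg_10 : reg (frac 1 0) = left base;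
  reg_11 : reg (frac 1 1) = left (rot base);
  reg_01 : reg (frac 0 1) = left (rot (rot base));
  reg_rule : forall (d : dart G) (k n k' n' : int),
    coprimez k n -> coprimez k' n' ->
    left d = reg (frac k n) -> left (opp d) = reg (frac k' n') ->
    let e := left (rot (rot d)) in
    let e' := left (rot (rot (opp d))) in
    let p := reg (frac (k + k') (n + n')) in
    let m := reg (frac (k - k') (n - n')) in
    (e = p /\ e' = m) \/ (e = m /\ e' = p);
  base_at_well : forall (l : region G -> R) (d : dart G),
    l = label G \/ sign_variant (label G) l -> negative_vertex_well l d ->
    [\/ d = base, d = rot base | d = rot (rot base)]
}.

Definition mstar (R : realType) (G : markov_topograph R)
    (F : farey_indexing G) (q : P1Q) : R := label G (reg F q).

Definition cosh (R : realType) (x : R) : R := (expR x + expR (- x)) / 2.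

Definition acosh (R : realType) (y : R) : R := ln (y + Num.sqrt (y ^+ 2 - 1)).

Lemma acosh_ge0 (R : realType) (y : R) : 1 <= y -> 0 <= acosh y.
Proof.
by move=> y1; apply: ln_ge0; rewrite (le_trans y1)// lerDl sqrtr_ge0.
Qed.

Lemma acoshK (R : realType) (y : R) : 1 <= y -> cosh (acosh y) = y.
Proof.
move=> y1; have s0 := sqrtr_ge0 (y ^+ 2 - 1).
have s2 : Num.sqrt (y ^+ 2 - 1) ^+ 2 = y ^+ 2 - 1.
  by rewrite sqr_sqrtr// subr_ge0 expr_ge1// (le_trans ler01).
rewrite /cosh /acosh expRN lnK; last by rewrite posrE; lra.
move: (Num.sqrt _) s0 s2 => s s0 s2.
have ys : y + s != 0 by apply: lt0r_neq0; lra.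
suff -> : (y + s)^-1 = y - s by field.
apply: (mulfI ys); rewrite mulfV//.
by have -> : (y + s) * (y - s) = y ^+ 2 - s ^+ 2; [ring|rewrite s2; ring].
Qed.

Definition rho (R : realType) (x : R) : R := acosh (x / 2).

Definition point_set (R : realType) (G : markov_topograph R)
    (F : farey_indexing G) : set (R * R) :=
  [set p | exists k n : int, coprimez k n /\
     p = (n%:~R / rho `|mstar F (frac k n)|,
          k%:~R / rho `|mstar F (frac k n)|)].

Definition polar_curve (R : realType) (rad : R -> R) : set (R * R) :=
  [set p | exists t, p = (rad t * cos t, rad t * sin t)].

(* [rad] is the polar radius, as a function of the angle, of a continuous closed
   curve about the origin which contains P. *)
Definition polar_extension (R : realType) (P : set (R * R)) (rad : R -> R) :=
  [/\ continuous rad, forall t, rad (t + 2 * pi) = rad t, forall t, 0 < rad t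
    & P `<=` polar_curve rad].

Definition polar_ball (R : realType) (rad : R -> R) : set (R * R) :=
  [set p | exists r t, 0 <= r <= rad t /\ p = (r * cos t, r * sin t)].

Definition area (R : realType) (A : set (R * R)) : R :=
  fine ((@lebesgue_measure R \x @lebesgue_measure R)%E A).

(* [fset_set] is the empty set on infinite sets, so a quadratic lower bound on
   this count entails that the counted sets are finite. *)
Definition label_count (R : realType) (G : markov_topograph R)
    (F : farey_indexing G) (X : R) : nat :=
  #|` fset_set [set q : P1Q | `|mstar F q| <= X]|%fset.

(* Main.v *)
(* Index the regions by primitive vectors [(n, k)] up to sign and put
   [f (n, k) = rho |m*_(k/n)|].  On an edge [p], [q] the labels satisfy
   [g (p + q) + g (p - q) = g p * g q].  When [D <> 4] some vertex is a source:
   every edge points away from it, in the sense that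
   [|g p * g q| <= 2 |g (p + q)|].  Away from the source [ln (|g| / 2)] is
   superadditive, so [f] grows linearly, and the vertex equation gives
   [|f (p + q) - f p - f q| <= C / |g p * g q|], which is exponentially small.
   Hence the linear forms interpolating [f] on the edges have bounded slopes,
   and [f] extends to a positive, homogeneous, Lipschitz gauge [E] on the plane;
   the curve is [E = 1].  Counting unit squares gives
   [#{u in Z^2 : E u <= T} = Area(E <= 1) T^2 + O(T)], Moebius inversion and
   Basel's [zeta(2) = pi^2 / 6] give [6 / pi^2 Area(E <= 1) T^2 + O(T log T)]
   primitive vectors, two for each region, and [T = rho X = ln X + O(1)]. *)

Require Import Defs.
From mathcomp Require Import all_boot all_order all_algebra.
From mathcomp Require Import all_classical all_reals all_analysis.
From mathcomp Require Import finmap zify ring lra.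

Set Implicit Arguments.
Unset Strict Implicit.
Unset Printing Implicit Defensive.

Import Order.TTheory GRing.Theory Num.Theory.
Import numFieldNormedType.Exports.
Local Open Scope classical_set_scope.
Local Open Scope ring_scope.

(** * Edge lengths *)

Section Rho.
Variable R : realType.
Implicit Types r s t x y : R.

(** For [D = 4] the lengths can be |alpha n + beta k| with alpha/beta irrational. The descent
    towards a source is then the Euclidean algorithm on two incommensurable lengths and never ends,
    and the curve is unbounded. [D <> 4] excludes this through a uniform drop of the labels in each
    step of the descent. The labels have arbitrary signs. Instead of passing to a sign variant, the
    proof records the sign of the product of the three labels at a vertex, which sign variants
    preserve. A small defect of additivity does not by itself bound the slopes: at each step along
    the tree the defect is multiplied by a coordinate of the edge, and these are unbounded. The
    slopes stay bounded because the labels grow exponentially in the sum of the coordinates, so that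
    the weighted defects are summable along every path, with one bound for all paths. The gauge is
    an infimum over multiples of lattice vectors rather than a limit of interpolating forms:
    homogeneity, the Lipschitz bound and the lower bound then come for all real vectors at once,
    irrational directions included. *)

Definition growth (x : R) : R := x / 2 + Num.sqrt ((x / 2) ^+ 2 - 1).

Lemma rhoE x : rho x = ln (growth x). Proof. by []. Qed.

(** [growth x] is e^(rho x), the larger root of z + 1/z = x. *)
Lemma growth_spec x : 2 < x -> [/\ 1 < growth x, x / 2 <= growth x,
  growth x <= x & growth x + (growth x)^-1 = x].
Proof.
move=> x2; pose y := x / 2; have xE : x = 2 * y by rewrite /y; lra.
have y1 : 1 < y by rewrite /y; lra.
rewrite /growth -/y xE.
have s0 := sqrtr_ge0 (y ^+ 2 - 1).
have s2 : Num.sqrt (y ^+ 2 - 1) ^+ 2 = y ^+ 2 - 1.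
  by rewrite sqr_sqrtr// subr_ge0 expr_ge1//; lra.
move: (Num.sqrt _) s0 s2 => s s0 s2; split; try nra.
have ys : y + s != 0 by apply: lt0r_neq0; lra.
suff -> : (y + s)^-1 = y - s by ring.
apply: (mulfI ys); rewrite mulfV//.
by have -> : (y + s) * (y - s) = y ^+ 2 - s ^+ 2; [ring|rewrite s2; ring].
Qed.

Lemma rho_gt0 x : 2 < x -> 0 < rho x.
Proof. by move=> /growth_spec[h _ _ _]; rewrite rhoE ln_gt0. Qed.

Lemma expR_rho x : 2 < x -> expR (rho x) = growth x.
Proof.
by move=> /growth_spec[h _ _ _]; rewrite rhoE lnK// posrE; lra.
Qed.

Lemma rho_inj x y : 2 < x -> 2 < y -> rho x = rho y -> x = y.
Proof.
move=> x2 y2 e.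
have [_ _ _ <-] := growth_spec x2; have [_ _ _ <-] := growth_spec y2.
suff -> : growth x = growth y by [].
by rewrite -(expR_rho x2) -(expR_rho y2) e.
Qed.

Lemma ler_rho x y : 2 < x -> 2 < y -> (rho x <= rho y) = (x <= y).
Proof.
have mono x' y' : 2 < x' -> x' <= y' -> rho x' <= rho y'.
  move=> x2 xy; have y2 : 2 < y' by lra.
  have [a1 _ _ _] := growth_spec x2; have [b1 _ _ _] := growth_spec y2.
  rewrite !rhoE ler_ln ?posrE; [|lra..].
  rewrite /growth lerD //; first by lra.
  rewrite ler_wsqrtr// lerD2r ler_sqr ?nnegrE; lra.
move=> x2 y2; apply/idP/idP; last exact: mono.
have [//|yx h] := leP x y.
have := mono _ _ y2 (ltW yx) => h'.
have /(rho_inj x2 y2) exy : rho x = rho y by apply/eqP; rewrite eq_le h h'.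
by rewrite exy ltxx in yx.
Qed.

Lemma rho_bounds x : 2 < x -> ln x - ln 2 <= rho x <= ln x.
Proof.
move=> x2; have [h1 h2 h3 _] := growth_spec x2.
rewrite rhoE -ln_div ?posrE; [|lra..].
by rewrite !ler_ln ?posrE ?h2 ?h3; lra.
Qed.

Lemma norm_ln_div (a b : R) (m : R) : 0 < m -> m <= a -> m <= b ->
  `|ln a - ln b| <= `|a - b| / m.
Proof.
move=> m0; wlog ab : a b / b <= a.
  move=> H ma mb; have [ba|/ltW ab] := leP b a; first exact: H.
  by rewrite distrC [X in _ <= X / _]distrC; exact: H.
move=> ma mb; have b0 : 0 < b by lra.
have a0 : 0 < a by lra.
rewrite -ln_div ?posrE// ger0_norm; last by apply: ln_ge0; rewrite ler_pdivlMr//; lra.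
rewrite [X in _ <= X / _]ger0_norm; last by lra.
have -> : a / b = 1 + (a - b) / b by field; lra.
apply: (@le_trans _ _ ((a - b) / b)).
  by apply: le_ln1Dx; rewrite (@lt_le_trans _ _ 0)// divr_ge0//; lra.
by rewrite ler_wpM2l ?lef_pV2 ?posrE; lra.
Qed.

(* With growths [l], [u] of [r], [s] the vertex equation is quadratic in [t], and
   for [D = 4] its roots are [l * u + (l * u)^-1] and [l / u + u / l]. *)
Lemma vertex_equation_roots l l' u u' t : l * l' = 1 -> u * u' = 1 ->
  (t - (l * u + l' * u')) * (t - (l * u' + u * l'))
  = (l + l') ^+ 2 + (u + u') ^+ 2 + t ^+ 2 - (l + l') * (u + u') * t - 4.
Proof.
move=> ll uu.
have -> : (t - (l * u + l' * u')) * (t - (l * u' + u * l'))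
  = t ^+ 2 - (l + l') * (u + u') * t
    + (l * l') * ((u + u') ^+ 2 - 2 * (u * u'))
    + (u * u') * ((l + l') ^+ 2 - 2 * (l * l')) by ring.
by rewrite ll uu; ring.
Qed.

(** If z + 1/z = x, then (z - 1/z)^2 = x^2 - 4. The product on the right is the distance between the
    two roots in [vertex_equation_roots], so the lemma keeps these roots apart. *)
Lemma growth_gap_prod (k x y : R) : 0 < k -> 4 + 4 * k <= x ^+ 2 -> 4 + 4 * k <= y ^+ 2 ->
  2 < x -> 2 < y ->
  4 * k <= (growth x - (growth x)^-1) * (growth y - (growth y)^-1).
Proof.
have gap z : 2 < z -> 0 <= growth z - (growth z)^-1 /\
    (growth z - (growth z)^-1) ^+ 2 = z ^+ 2 - 4.
  move=> z2; have [g1 _ _ gE] := growth_spec z2.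
  have g0 : 0 < growth z by lra.
  have gg : growth z * (growth z)^-1 = 1 by rewrite mulfV// gt_eqF.
  split; first by rewrite subr_ge0 (le_trans _ (ltW g1))// invf_le1// ltW.
  rewrite -[in RHS]gE; move: (growth z)^-1 gg => g' gg.
  by rewrite (_ : _ ^+ 2 = (growth z + g') ^+ 2 - 4 * (growth z * g')); [rewrite gg; ring|ring].
move=> k0 kx ky /gap[x0 xE] /gap[y0 yE].
have k4 : 0 <= 4 * k by lra.
rewrite -(@ler_sqr _ (4 * k)) ?nnegrE ?mulr_ge0 ?(ltW k0)//.
by rewrite [leRHS]exprMn xE yE expr2 ler_pM//; lra.
Qed.

(** With t = n + 1/n the difference on the right factors as (n - p)(1 - 1/(n p)), and n p >= 1 +
    k. *)
Lemma growth_defect (k t p : R) : 0 < k -> 1 + k <= p -> 2 < t ->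
  `|growth t - p| * (k / (1 + k)) <= `|t - (p + p^-1)|.
Proof.
move=> k0 kp t2; have [n1 _ _ nE] := growth_spec t2.
have p0 : 0 < p by lra.
have n0 : 0 < growth t by lra.
rewrite -[in leRHS]nE; move: (growth t) n0 n1 => n n0 n1.
have -> : n + n^-1 - (p + p^-1) = (n - p) * (1 - n^-1 * p^-1) by field; rewrite !gt_eqF.
have n'1 : n^-1 * p^-1 <= (1 + k)^-1.
  rewrite -invfM lef_pV2 ?posrE ?mulr_gt0//; last by lra.
  by rewrite (le_trans kp)// ler_peMl// ltW.
have kE : k / (1 + k) = 1 - (1 + k)^-1 by field; lra.
rewrite normrM ler_wpM2l// (le_trans _ (ler_norm _))// kE; lra.
Qed.

(** The distances from [t] to the two roots of [vertex_equation_roots] have product |D - 4|. As [t]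
    stays away from the lower root, it is within a constant of the upper one, l u + 1/(l u), and
    [growth t] is within a constant of l u. Both are at least r s / 4, so taking logarithms divides
    the error by r s. *)
Lemma rho_almost_additive (D m : R) : 2 < m -> exists2 C : R, 0 < C &
  forall r s t, m <= r -> m <= s -> m <= t ->
  r ^+ 2 + s ^+ 2 + t ^+ 2 - r * s * t = D -> r * s <= 2 * t ->
  `|rho t - rho r - rho s| <= C / (r * s).
Proof.
move=> m2; set k := m ^+ 2 / 4 - 1.
have k0 : 0 < k by rewrite /k; nra.
have k10 : 0 < 1 + k by lra.
have kk0 : 0 < k / (1 + k) by rewrite divr_gt0.
have m_sq x : m <= x -> 4 + 4 * k <= x ^+ 2.
  by move=> mx; rewrite (_ : _ + _ = m ^+ 2); [rewrite ler_sqr ?nnegrE; lra|rewrite /k; lra].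
exists (4 * ((`|D - 4| + 1) / (2 * k) / (k / (1 + k)))) => [|r s t mr ms mt eD h].
  by rewrite mulr_gt0// divr_gt0// divr_gt0 ?mulr_gt0// ltr_wpDl.
have [r2 s2 t2] : [/\ 2 < r, 2 < s & 2 < t] by clear -m2 mr ms mt; split; lra.
have gap := growth_gap_prod k0 (m_sq _ mr) (m_sq _ ms) r2 s2.
have def := growth_defect k0 _ t2.
have [l1 l2 _ lE] := growth_spec r2.
have [u1 u2 _ uE] := growth_spec s2.
have [n1 n2 _ _] := growth_spec t2.
rewrite !rhoE.
move: (growth r) (growth s) (growth t) l1 l2 lE u1 u2 uE n1 n2 gap def.
move=> l u n l1 l2 lE u1 u2 uE n1 n2 gap def.
have l0 : 0 < l by clear -l1; lra.
have u0 : 0 < u by clear -u1; lra.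
have n0 : 0 < n by clear -n1; lra.
have r0 : 0 < r by clear -r2; lra.
have s0 : 0 < s by clear -s2; lra.
have rs0 : 0 < r * s / 4 by rewrite divr_gt0// mulr_gt0.
have rs_lu : r * s / 4 <= l * u.
  rewrite (_ : _ / 4 = (r / 2) * (s / 2)); last by field.
  by rewrite ler_pM// divr_ge0// ltW.
have klu : 1 + k <= l * u.
  apply: le_trans rs_lu; rewrite ler_pdivlMr//.
  have : m * m <= r * s by clear -m2 mr ms; apply: ler_pM; lra.
  by rewrite /k expr2; lra.
have {}def := def _ klu.
have lV : l * l^-1 = 1 by rewrite mulfV// gt_eqF.
have uV : u * u^-1 = 1 by rewrite mulfV// gt_eqF.
have := vertex_equation_roots t lV uV; rewrite lE uE eD.
rewrite -invfM => e1.
have e2 : (t - (l * u + (l * u)^-1)) + (t - (l / u + u / l)) = 2 * t - r * s.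
  by rewrite -lE -uE; field; rewrite !gt_eqF.
have e3 : (l * u + (l * u)^-1) - (l / u + u / l) = (l - l^-1) * (u - u^-1).
  by field; rewrite !gt_eqF.
(* The roots have sum [r * s <= 2 * t], so [t] is not below their midpoint, and they are at least
   [4 * k] apart. *)
have h2 : 2 * k <= t - (l / u + u / l).
  by clear -h gap e2 e3; lra.
have h4 : `|ln n - ln (l * u)| <= `|n - l * u| / (r * s / 4).
  by apply: norm_ln_div => //; clear -n2 h; lra.
rewrite lnM ?posrE// opprD addrA in h4; apply: (le_trans h4).
have -> : `|n - l * u| / (r * s / 4) = 4 * `|n - l * u| / (r * s) by field; rewrite !gt_eqF.
rewrite ler_pM2r ?invr_gt0 ?mulr_gt0//.
rewrite ler_pM2l// ler_pdivlMr// (le_trans def)//.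
rewrite ler_pdivlMr ?mulr_gt0// (@le_trans _ _ `|D - 4|) ?lerDl//.
by rewrite -e1 normrM ler_wpM2l// (le_trans h2)// ler_norm.
Qed.

End Rho.

(** * The Farey indexing *)

(* From an edge pair [v], [w] one reaches the pairs made of one of [v], [w] and
   one of [v + w], [v - w], hence all pairs of determinant 1 or -1, by the
   Euclidean algorithm on the second coordinates. *)
Lemma unimodular_ind (P : int -> int -> int -> int -> Prop) :
  P 1 0 0 1 ->
  (forall a b c d, P a b c d -> P c d a b) ->
  (forall a b c d, P a b c d -> P (- a) (- b) c d) ->
  (forall a b c d, P a b c d -> P (a + c) (b + d) c d) ->
  forall a b c d, (a * d - b * c) ^+ 2 = 1 -> P a b c d.
Proof.
move=> P0 Psym Popp Padd.
have Psub (a b c d : int) : P (a + c) (b + d) c d -> P a b c d.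
  move=> h; have := Padd _ _ _ _ (Popp _ _ _ _ h).
  by move=> /Popp; rewrite !opprD !opprK !addrK.
have Psub' (a b c d : int) : P (a - c) (b - d) c d -> P a b c d.
  by move=> /Padd; rewrite !subrK.
suff H (n : nat) (a b c d : int) : (absz b + absz d <= n)%N -> (a * d - b * c) ^+ 2 = 1 -> P a b c d.
  by move=> a b c d; exact: H (leqnn _).
elim: n a b c d => [|n IH] a b c d bd e.
  have [b0 d0] : b = 0 /\ d = 0 by lia.
  by move: e; rewrite b0 d0 mulr0 mul0r subr0 expr0n.
have key (a' c' : int) : (a' = 1 \/ a' = - 1) -> P a' 0 c' 1.
  move=> ha'; have H0 : P a' 0 0 1.
    by case: ha' => ->//; have := Popp _ _ _ _ P0; rewrite oppr0.
  elim/int_ind: c' => [//|m h|m h].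
  - apply: (Psym); case: ha' h => -> h.
    + have /Padd := Psym _ _ _ _ h; rewrite addr0.
      by have -> : m%:Z + 1 = m.+1 by lia.
    + apply: (Psub); rewrite addr0.
      by have -> : m.+1%:Z + - 1 = m; [lia|exact: Psym].
  - apply: (Psym); case: ha' h => -> h.
    + apply: (Psub); rewrite addr0.
      by have -> : - m.+1%:Z + 1 = - m%:Z; [lia|exact: Psym].
    + have /Padd := Psym _ _ _ _ h; rewrite addr0.
      by have -> : - m%:Z + - 1 = - m.+1%:Z by lia.
have key' (a' c' d' : int) : (a' = 1 \/ a' = - 1) -> (d' = 1 \/ d' = - 1) -> P a' 0 c' d'.
  move=> ha' [->|->]; first exact: key.
  have := Popp _ _ _ _ (Psym _ _ _ _ (key a' (- c') ha')); rewrite opprK.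
  exact: Psym.
have unit2 (x y : int) : (x * y) ^+ 2 = 1 -> (x = 1 \/ x = -1) /\ (y = 1 \/ y = -1).
  move=> /eqP; rewrite sqrf_eq1 => /orP h.
  have /eqP : absz (x * y) = 1%N by case: h => /eqP ->.
  by rewrite abszM muln_eq1 => /andP[/eqP hx /eqP hy]; split; lia.
have [b0|b0] := eqVneq b 0.
  move: e; rewrite b0 mul0r subr0 => /unit2[ha hd]; exact: key'.
have [d0|d0] := eqVneq d 0.
  move: e; rewrite d0 mulr0 sub0r sqrrN => /unit2[hb hc].
  by apply: Psym; exact: key'.
have IH1 : (absz (b + d)%R + absz d <= n)%N -> P a b c d.
  by move=> h; apply: (Psub); apply: IH => //; rewrite -e; ring.
have IH2 : (absz (b - d)%R + absz d <= n)%N -> P a b c d.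
  by move=> h; apply: Psub'; apply: IH => //; rewrite -e; ring.
have IH3 : (absz (d + b)%R + absz b <= n)%N -> P a b c d.
  by move=> h; apply/Psym/Psub; apply: IH => //; rewrite -e; ring.
have IH4 : (absz (d - b)%R + absz b <= n)%N -> P a b c d.
  by move=> h; apply/Psym/Psub'; apply: IH => //; rewrite -e; ring.
have : [\/ (absz (b + d)%R + absz d <= n)%N, (absz (b - d)%R + absz d <= n)%N,
  (absz (d + b)%R + absz b <= n)%N | (absz (d - b)%R + absz b <= n)%N].
  have [h|h] := boolP (absz b <= absz d)%N; have [b1|b1] := boolP (0 <= b);
    have [d1|d1] := boolP (0 <= d);
    first [apply: Or41; lia|apply: Or42; lia|apply: Or43; lia|apply: Or44; lia].
by case.
Qed.

Section FromTopograph.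
Variables (R : realType) (G : markov_topograph R) (F : farey_indexing G).

Definition edge_pair (a b c d : int) := exists e : dart (tree G),
  left e = Defs.reg F (Defs.frac b a) /\ left (Defs.opp e) = Defs.reg F (Defs.frac d c).

Lemma left_rot (e : dart G) : left (Defs.rot e) = left (Defs.opp e).
Proof.
rewrite -[in LHS](oppK e); apply/left_eqP.
by apply: Relation_Operators.rst_sym; exact: Relation_Operators.rst_step.
Qed.

Lemma fracN k n : Defs.frac (- k) (- n) = Defs.frac k n.
Proof.
by rewrite /Defs.frac oppr_eq0; case: eqP => // _; rewrite !rmorphN invrN mulrNN.
Qed.

Lemma coprime_unimodular (a b c d : int) : (a * d - b * c) ^+ 2 = 1 ->
  coprimez b a /\ coprimez d c.
Proof.
move=> e; have {e} : a * d - b * c = 1 \/ a * d - b * c = -1 by nia.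
by move=> [] e; split; apply/coprimezP;
  [exists (- c, d)|exists (a, - b)|exists (c, - d)|exists (- a, b)] => /=; lia.
Qed.

(** The regions at the two ends of an edge are adjacent to those on its sides, so edge pairs are
    closed under the moves of [unimodular_ind]. Because [reg_rule] leaves the ends unordered, sum
    and difference are treated together. *)
Lemma edge_pairP a b c d : (a * d - b * c) ^+ 2 = 1 -> edge_pair a b c d.
Proof.
pose P a b c d := (a * d - b * c) ^+ 2 = 1 /\ edge_pair a b c d.
move=> e; suff: P a b c d by case.
have sym (a' b' c' d' : int) : P a' b' c' d' -> P c' d' a' b'.
  move=> [e' [x [h1 h2]]]; split; first by rewrite -e'; ring.
  by exists (Defs.opp x); rewrite oppK.
have neg (a' b' c' d' : int) : P a' b' c' d' -> P (- a') (- b') c' d'.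
  move=> [e' [x [h1 h2]]]; split; first by rewrite -e'; ring.
  by exists x; rewrite fracN.
have both (a' b' c' d' : int) : P a' b' c' d' ->
    P (a' + c') (b' + d') c' d' /\ P (a' - c') (b' - d') c' d'.
  move=> [e' [x [h1 h2]]].
  have [cop1 cop2] := coprime_unimodular e'.
  have := reg_rule cop1 cop2 h1 h2.
  have e1 : ((a' + c') * d' - (b' + d') * c') ^+ 2 = 1 by rewrite -e'; ring.
  have e2 : ((a' - c') * d' - (b' - d') * c') ^+ 2 = 1 by rewrite -e'; ring.
  have h1' : left (Defs.opp (Defs.rot x)) = left (Defs.rot (Defs.rot x)) by rewrite left_rot.
  have h2' : left (Defs.rot (Defs.rot (Defs.opp x))) = left (Defs.opp (Defs.rot (Defs.opp x))).
    by rewrite left_rot.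
  have h3' : left (Defs.opp (Defs.rot (Defs.rot (Defs.opp x)))) = left (Defs.opp x).
    by rewrite -left_rot Defs.rotK.
  case=> -[hp hm].
  - split; split=> //.
      by apply: (@sym _ _ _ _ (conj _ _)).2; [rewrite -e1; ring|];
        exists (Defs.rot x); rewrite left_rot h1'.
    by exists (Defs.rot (Defs.rot (Defs.opp x))); rewrite h3'.
  - split; split=> //.
      by exists (Defs.rot (Defs.rot (Defs.opp x))); rewrite h3'.
    by apply: (@sym _ _ _ _ (conj _ _)).2; [rewrite -e2; ring|];
      exists (Defs.rot x); rewrite left_rot h1'.
apply: (@unimodular_ind P) => //.
(* The dart [base] separates 1/0 from 1/1. One subtraction and one addition lead from there to the
   edge between (1, 0) and (0, 1). *)
- have base_pair : P 0 1 1 1.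
    split=> //; exists (base F); rewrite -reg_10 -left_rot -reg_11; split=> //.
  have [_ /sym] := both _ _ _ _ base_pair; rewrite !subrr sub0r => /both[+ _].
  by rewrite subrr addr0 => /sym/neg; rewrite opprK oppr0.
- by move=> a' b' c' d' /both[].
Qed.


Definition index_label (a b : int) : R := mstar F (Defs.frac b a).

Lemma index_labelN a b : index_label (- a) (- b) = index_label a b.
Proof. by rewrite /index_label fracN. Qed.

Variable D : R.
Hypothesis discr : has_discriminator G D.

Lemma index_label_topograph a b c d : (a * d - b * c) ^+ 2 = 1 ->
  [/\ index_label (a + c) (b + d) + index_label (a - c) (b - d)
       = index_label a b * index_label c d,
    index_label a b ^+ 2 + index_label c d ^+ 2 + index_label (a + c) (b + d) ^+ 2
       - index_label a b * index_label c d * index_label (a + c) (b + d) = D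
    & index_label a b ^+ 2 + index_label c d ^+ 2 + index_label (a - c) (b - d) ^+ 2
       - index_label a b * index_label c d * index_label (a - c) (b - d) = D].
Proof.
move=> e; have [x [h1 h2]] := edge_pairP e.
have [cop1 cop2] := coprime_unimodular e.
have := reg_rule cop1 cop2 h1 h2.
have := edge_rule x; have := discr x; have := discr (Defs.opp x).
rewrite /vertex_discriminator /index_label /mstar !left_rot oppK -h1 -h2.
by move=> d1 d2 e3 /= [[<- <-]|[<- <-]]; split; rewrite -?e3 -?d2 -?d1 -1?e3; ring.
Qed.

End FromTopograph.

(** * Existence of a source *)

Section Topograph.
Variable R : realType.
Implicit Types (g : int -> int -> R) (D : R) (r s t : R).

Record topograph D g : Prop := Topograph {
  topograph_edge : forall a b c d, (a * d - b * c) ^+ 2 = 1 ->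
    g (a + c) (b + d) + g (a - c) (b - d) = g a b * g c d;
  topograph_vertex : forall a b c d, (a * d - b * c) ^+ 2 = 1 ->
    g a b ^+ 2 + g c d ^+ 2 + g (a + c) (b + d) ^+ 2
      - g a b * g c d * g (a + c) (b + d) = D;
  topograph_even : forall a b, g (- a) (- b) = g a b;
  topograph_gt2 : forall a b, 2 < `|g a b|
}.

Arguments topograph_edge {D g} _ a b c d _.
Arguments topograph_vertex {D g} _ a b c d _.

(** Pullback along the linear map taking (1, 0) to (p, q) and (0, 1) to (r, s). It moves a source to
    the standard vertex, and each edge of a source to the standard quadrant. *)
Definition rebase (p q r s : int) g : int -> int -> R :=
  fun x y => g (x * p + y * r) (x * q + y * s).

Lemma rebase_topograph D g (p q r s : int) : (p * s - q * r) ^+ 2 = 1 ->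
  topograph D g -> topograph D (rebase p q r s g).
Proof.
move=> e [h1 h2 h3 h4]; split=> [a b c d e'|a b c d e'|a b|a b]; rewrite /rebase //.
- rewrite -h1.
    by congr (g _ _ + g _ _); ring.
  by rewrite -[RHS]e -[RHS]mulr1 -[in RHS]e'; ring.
- rewrite -[RHS](h2 (a * p + b * r) (a * q + b * s) (c * p + d * r) (c * q + d * s)).
    have -> : (a + c) * p + (b + d) * r = a * p + b * r + (c * p + d * r) by ring.
    by have -> : (a + c) * q + (b + d) * s = a * q + b * s + (c * q + d * s) by ring.
  by rewrite -[RHS]e -[RHS]mulr1 -[in RHS]e'; ring.
- by rewrite -h3; congr g; ring.
Qed.

(** The sign condition says that some sign variant is positive at the vertex ahead, so that the
    vertex equation there also holds for the absolute values. *)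
Definition outward g (a b c d : int) :=
  0 < g a b * g c d * g (a + c) (b + d) /\
  `|g a b * g c d| <= 2 * `|g (a + c) (b + d)|.

(* The vertex of the regions [(1, 0)], [(0, 1)], [(1, 1)] is a source: its three
   edges point outward. *)
Definition source g :=
  [/\ outward g 1 0 0 (-1), outward g 1 0 1 1 & outward g 0 1 1 1].

Lemma back_product r s t : 0 < r * s * t ->
  r * s * (r * s - t) = (`|r| * `|s|) * (`|r| * `|s| - `|t|).
Proof.
move=> p; have -> : r * s * (r * s - t) = (r * s) ^+ 2 - r * s * t by ring.
rewrite -(gtr0_norm p) !normrM -[(r * s) ^+ 2]real_normK ?num_real// normrM.
ring.
Qed.

Lemma back_norm r s t : 0 < r * s * t -> 0 < r * s * (r * s - t) ->
  `|r * s - t| = `|r| * `|s| - `|t|.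
Proof.
move=> p p'; have rs0 : `|r * s| != 0.
  by apply: contraTneq p' => /normr0_eq0 ->; rewrite mul0r ltxx.
by apply: (mulfI rs0); rewrite -normrM gtr0_norm// back_product// normrM.
Qed.

Lemma outward_pos_back r s t : 2 < `|r| -> 2 < `|s| -> 2 < `|t| ->
  0 < r * s * t -> 2 * `|t| <= `|r| * `|s| ->
  0 < r * s * (r * s - t) /\ `|r * s| <= 2 * `|r * s - t|.
Proof.
move=> hr hs ht p h.
have rs0 : 0 < `|r| * `|s| by rewrite mulr_gt0//; lra.
have p' : 0 < r * s * (r * s - t) by rewrite back_product// mulr_gt0//; lra.
by split=> //; rewrite back_norm// normrM; lra.
Qed.

(** As |r| > 2, the hypothesis gives |s| < |t|, hence 2|s| <= |r t|: across the next edge the label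
    behind is at most half the product. Outwardness thus propagates away from the source. *)
Lemma outward_pos r s t : 0 < r * s * t -> `|r * s| <= 2 * `|t| ->
  2 < `|r| -> 2 < `|s| -> 2 < `|t| ->
  0 < r * t * (t * r - s) /\ `|r * t| <= 2 * `|t * r - s|.
Proof.
move=> p h hr hs ht; rewrite [t * r]mulrC; apply: outward_pos_back => //.
  by rewrite mulrAC.
move: h hr hs ht; rewrite normrM.
move: `|r| `|s| `|t| => x y z h hx hy hz.
have hzy : y < z by nra.
by nra.
Qed.

(** Here [t] and [r * s] have opposite signs, so nothing cancels in [r * s - t]. *)
Lemma outward_neg r s t : r * s * t < 0 ->
  0 < r * s * (r * s - t) /\ `|r * s| <= 2 * `|r * s - t|.
Proof.
move=> p; have h : 0 < r * s * (r * s - t).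
  by have := sqr_ge0 (r * s); nra.
split=> //.
have : (r * s) ^+ 2 <= (r * s - t) ^+ 2 by have := sqr_ge0 t; nra.
by rewrite -(real_normK (num_real (r * s))) -(real_normK (num_real (_ - _))) ler_sqr ?nnegrE//;
  have := normr_ge0 (r * s - t); lra.
Qed.

(** A descent step replaces [t] by [r * s - t < s] and so lowers the sum of the labels by more than
    [t - s]. By [eqD], D > 4 gives (t - s)^2 >= D - 4. If D < 4, then [eqD] keeps [r - 2] above (4 -
    D)/B^2, and [r * s - t < s] gives t - s > (r - 2) s. No uniform gap survives at D = 4, where [r]
    may approach 2. *)
Lemma descent_gap D B : D <> 4 -> 0 < B -> exists2 e : R, 0 < e &
  forall r s t, 2 < r -> r <= s -> s <= t -> t <= B ->
    r ^+ 2 + s ^+ 2 + t ^+ 2 - r * s * t = D -> r * s - t < s -> e <= t - s.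
Proof.
move=> D4 B0.
have eqD r s t : r ^+ 2 + s ^+ 2 + t ^+ 2 - r * s * t - 4
    = (t - s) ^+ 2 - (r - 2) * (s * t - r - 2) by ring.
have [D_gt|D_le] := ltP 4 D.
- exists (Num.sqrt (D - 4)) => [|r s t r2 rs st tB eD h]; first by rewrite sqrtr_gt0; lra.
  rewrite -(@ler_sqr _ (Num.sqrt _)) ?nnegrE ?sqrtr_ge0//; last by lra.
  rewrite sqr_sqrtr; last by lra.
  rewrite -eD eqD.
  have : r + 2 <= s * t by nra.
  move=> ?; have : 0 <= (r - 2) * (s * t - r - 2) by rewrite mulr_ge0//; lra.
  lra.
- have D_lt : D < 4 by move: D_le; rewrite le_eqVlt => /orP[/eqP|].
  exists (2 * ((4 - D) / B ^+ 2)) => [|r s t r2 rs st tB eD h].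
    by rewrite mulr_gt0// divr_gt0// ?subr_gt0// exprn_gt0.
  have h1 : (4 - D) / B ^+ 2 <= r - 2.
    rewrite ler_pdivrMr ?exprn_gt0// -eD.
    have h2 : s * t <= B ^+ 2 by rewrite expr2 ler_pM//; lra.
    have := eqD r s t; have := sqr_ge0 (t - s).
    have : (r - 2) * (s * t - r - 2) <= (r - 2) * B ^+ 2 by rewrite ler_wpM2l; lra.
    lra.
  have : 0 < (4 - D) / B ^+ 2 by rewrite divr_gt0// ?subr_gt0// exprn_gt0.
  by move=> ?; nra.
Qed.

Lemma rebaseK (p q r s p' q' r' s' : int) g : rebase p' q' r' s' (rebase p q r s g) =
  rebase (p' * p + q' * r) (p' * q + q' * s) (r' * p + s' * r) (r' * q + s' * s) g.
Proof. by apply/funext => x; apply/funext => y; rewrite /rebase; congr g; ring. Qed.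

Definition has_source g := exists p q r s : int,
  (p * s - q * r) ^+ 2 = 1 /\ source (rebase p q r s g).

Lemma source_has_source g : source g -> has_source g.
Proof.
by move=> h; exists 1, 0, 0, 1.
Qed.

Lemma has_source_rebase (p q r s : int) g : (p * s - q * r) ^+ 2 = 1 ->
  has_source (rebase p q r s g) -> has_source g.
Proof.
move=> e [p' [q' [r' [s' [e']]]]]; rewrite rebaseK => h.
by do 4 eexists; split; last exact: h; rewrite -[RHS]e -[RHS]mulr1 -[in RHS]e'; ring.
Qed.

Section Source.
Variables (D : R) (g : int -> int -> R).
Hypothesis gT : topograph D g.
Local Notation r := (g 1 0).
Local Notation s := (g 0 1).
Local Notation t := (g 1 1).

Lemma label_values : [/\ g 1 (-1) = r * s - t, g 2 1 = t * r - s & g 1 2 = t * s - r].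
Proof.
split.
- by have := topograph_edge gT 1 0 0 1 erefl => <-; rewrite addrC addKr.
- have := topograph_edge gT 1 1 1 0 erefl => <-.
  by rewrite addrK.
- have := topograph_edge gT 1 1 0 1 erefl => <-.
  by rewrite addrK.
Qed.

Lemma sourceE : source g <->
  [/\ 0 < r * s * (r * s - t) /\ `|r * s| <= 2 * `|r * s - t|,
      0 < r * t * (t * r - s) /\ `|r * t| <= 2 * `|t * r - s|
    & 0 < s * t * (t * s - r) /\ `|s * t| <= 2 * `|t * s - r|].
Proof.
have [<- <- <-] := label_values; rewrite /source /outward.
have -> : g 0 (-1) = s by rewrite -[in LHS]oppr0 (topograph_even gT).
by [].
Qed.

Lemma labels_gt2 : [/\ 2 < `|r|, 2 < `|s| & 2 < `|t|].
Proof. by split; exact: topograph_gt2 gT _ _. Qed.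

Lemma vertex_abs : 0 < r * s * t ->
  `|r| ^+ 2 + `|s| ^+ 2 + `|t| ^+ 2 - `|r| * `|s| * `|t| = D.
Proof.
move=> p; rewrite !real_normK ?num_real// -!normrM gtr0_norm//.
exact: (topograph_vertex gT 1 0 0 1 erefl).
Qed.

(** Such a vertex is a negative vertex well of some sign variant. *)
Lemma source_neg : r * s * t < 0 -> source g.
Proof.
move=> p; apply/sourceE; split; first exact: outward_neg.
- by rewrite [t * r]mulrC; apply: outward_neg; rewrite mulrAC.
- by rewrite [t * s]mulrC; apply: outward_neg; rewrite mulrC mulrA.
Qed.

Lemma source_pos : 0 < r * s * t -> 2 * `|t| <= `|r| * `|s| ->
  2 * `|s| <= `|r| * `|t| -> 2 * `|r| <= `|s| * `|t| -> source g.
Proof.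
have [r2 s2 t2] := labels_gt2.
move=> p h1 h2 h3; apply/sourceE; split; first exact: outward_pos_back.
- by rewrite [t * r]mulrC; apply: outward_pos_back; rewrite // mulrAC.
- by rewrite [t * s]mulrC; apply: outward_pos_back; rewrite // mulrC mulrA.
Qed.

End Source.

Definition total g : R := `|g 1 0| + `|g 0 1| + `|g 1 1|.

(** With the labels ordered, only the edge opposite the largest one can point inward. If it does,
    the vertex across it is examined: it is a source if its product is negative, or if the new label
    is at least the middle one. Otherwise the move lowers the total by at least [e]. *)
Lemma descent_step D B e g : topograph D g ->
  (forall r s t, 2 < r -> r <= s -> s <= t -> t <= B ->
    r ^+ 2 + s ^+ 2 + t ^+ 2 - r * s * t = D -> r * s - t < s -> e <= t - s) ->
  total g <= B -> `|g 1 0| <= `|g 0 1| -> `|g 0 1| <= `|g 1 1| ->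
  has_source g \/
  exists p q r s : int, [/\ (p * s - q * r) ^+ 2 = 1 &
    total (rebase p q r s g) <= total g - e].
Proof.
move=> gT gap gB rs st.
have [r2 s2 t2] := labels_gt2 gT.
have gT' : topograph D (rebase 1 0 0 (-1) g) by exact: rebase_topograph gT.
have [r2' s2' t2'] := labels_gt2 gT'.
have [v1 v2 v3] := label_values gT.
have nz (x : R) : 2 < `|x| -> x != 0 by rewrite -normr_gt0; lra.
have e10 : rebase 1 0 0 (-1) g 1 0 = g 1 0 by [].
have e01 : rebase 1 0 0 (-1) g 0 1 = g 0 1.
  by rewrite /rebase -[LHS](topograph_even gT).
have e11 : rebase 1 0 0 (-1) g 1 1 = g 1 0 * g 0 1 - g 1 1 by rewrite -v1.
have [p|p] := ltP 0 (g 1 0 * g 0 1 * g 1 1); last first.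
  left; apply/source_has_source/(source_neg gT).
  by rewrite lt_neqAle p andbT !mulf_neq0// nz.
have vD := vertex_abs gT p.
have [h|h] := leP (2 * `|g 1 1|) (`|g 1 0| * `|g 0 1|).
  by left; apply/source_has_source/(source_pos gT) => //; nra.
have [p'|p'] := ltP 0 (g 1 0 * g 0 1 * (g 1 0 * g 0 1 - g 1 1)); last first.
  left; apply: (@has_source_rebase 1 0 0 (-1)) => //.
  apply/source_has_source/(source_neg gT').
  by rewrite e10 e01 e11 lt_neqAle p' andbT !mulf_neq0// nz// -e11.
have t'E : `|g 1 0 * g 0 1 - g 1 1| = `|g 1 0| * `|g 0 1| - `|g 1 1|.
  exact: back_norm.
have [h'|h'] := leP `|g 0 1| (`|g 1 0| * `|g 0 1| - `|g 1 1|).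
  left; apply: (@has_source_rebase 1 0 0 (-1)) => //.
  apply/source_has_source/(source_pos gT'); rewrite e10 e01 e11 ?t'E//; nra.
right; exists 1, 0, 0, (-1); split=> //.
rewrite /total e10 e01 e11 t'E.
have tB : `|g 1 1| <= B by move: gB; rewrite /total; lra.
have := gap _ _ _ r2 rs st tB vD h'.
lra.
Qed.

Lemma topograph_has_source D g : D <> 4 -> topograph D g -> has_source g.
Proof.
move=> D4 gT.
have B0 : 0 < total g by have [] := labels_gt2 gT; rewrite /total; lra.
have [e e0 gap] := descent_gap D4 B0.
(* [n] bounds the number of remaining descent steps; keeping the total below [total g] keeps the
   same gap [e] valid. *)
suff H n : forall g', topograph D g' -> total g' <= total g -> total g' <= n%:R * e ->
    has_source g'.
  have [n hn] : exists n : nat, total g <= n%:R * e.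
    exists (Num.bound (total g / e)); rewrite -ler_pdivrMr// ltW//.
    by rewrite archi_boundP// divr_ge0// ltW.
  exact: (H n).
elim: n => [|n IH] g' g'T g'B g'n.
  by have [] := labels_gt2 g'T; move: g'n; rewrite mul0r /total; lra.
have main g1 : topograph D g1 -> total g1 = total g' -> `|g1 1 0| <= `|g1 0 1| ->
    `|g1 0 1| <= `|g1 1 1| -> has_source g1.
  move=> g1T g1E le1 le2; rewrite -g1E in g'B g'n.
  have [//|[p [q [r [s [u h]]]]]] := descent_step g1T gap g'B le1 le2.
  apply: (has_source_rebase u); apply: IH.
  - exact: rebase_topograph.
  - by rewrite (le_trans h)//; lra.
  - rewrite (le_trans h)//; move: g'n; rewrite -natr1 mulrDl mul1r; lra.
have reb (p q r s : int) : (p * s - q * r) ^+ 2 = 1 -> 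
    total (rebase p q r s g') = total g' ->
    `|rebase p q r s g' 1 0| <= `|rebase p q r s g' 0 1| ->
    `|rebase p q r s g' 0 1| <= `|rebase p q r s g' 1 1| -> has_source g'.
  move=> u tE le1 le2; apply: (has_source_rebase u); apply: main => //.
  exact: rebase_topograph.
have e1 : g' (-1) 0 = g' 1 0 by rewrite -[in LHS]oppr0 (topograph_even g'T).
have e2 : g' 0 (-1) = g' 0 1 by rewrite -[in LHS]oppr0 (topograph_even g'T).
have e3 : g' (-1) (-1) = g' 1 1 by rewrite (topograph_even g'T).
(* Six bases of the same vertex, one for each order of its three labels; the minus signs make the
   sum of the basis vectors the third region up to sign. *)
have := reb 1 0 0 1 erefl; have := reb 0 1 1 0 erefl.
have := reb 1 1 (-1) 0 erefl; have := reb (-1) 0 1 1 erefl.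
have := reb 1 1 0 (-1) erefl; have := reb 0 (-1) 1 1 erefl.
rewrite /total /rebase /= ?(mul0r, mul1r, add0r, addr0, subrr, addNr, addrN).
rewrite ?(addrK, addKr, e1, e2, e3).
move: `|g' 1 0| `|g' 0 1| `|g' 1 1| => x y z P1 P2 P3 P4 P5 P6.
case: (leP x y) => [|/ltW] xy; case: (leP y z) => [|/ltW] yz;
  case: (leP x z) => [|/ltW] xz;
  by [apply: P1 => //; ring|apply: P2 => //; ring|apply: P3 => //; ring
     |apply: P4 => //; ring|apply: P5 => //; ring|apply: P6 => //; ring
     |apply: P6 => //; apply: le_trans xz yz
     |apply: P2 => //; [ring|apply: le_trans yz xz]].
Qed.
End Topograph.

Arguments topograph_edge {R D g} _ a b c d _.
Arguments topograph_vertex {R D g} _ a b c d _.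

(** * Growth away from the source *)

(** This is the Stern-Brocot tree: in a unimodular basis of the quadrant other than the standard
    one, one vector dominates the other coordinatewise and can be reduced by it. *)
Lemma quadrant_ind (P : int -> int -> int -> int -> Prop) :
  P 1 0 0 1 ->
  (forall a b c d, 0 <= a -> 0 <= b -> 0 <= c -> 0 <= d -> a * d - b * c = 1 ->
    P a b c d -> P a b (a + c) (b + d) /\ P (a + c) (b + d) c d) ->
  forall a b c d, 0 <= a -> 0 <= b -> 0 <= c -> 0 <= d -> a * d - b * c = 1 ->
    P a b c d.
Proof.
move=> P0 Pstep.
suff H (n : nat) (a b c d : int) : a + b + c + d <= n%:Z ->
    0 <= a -> 0 <= b -> 0 <= c -> 0 <= d -> a * d - b * c = 1 -> P a b c d.
  move=> a b c d *; apply: (H (absz (a + b + c + d)%R)) => //; lia.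
elim: n a b c d => [|n IH] a b c d sn a0 b0 c0 d0 e; first by nia.
have cd1 : 1 <= c + d by nia.
have ab1 : 1 <= a + b by nia.
have [h|h] := boolP ((c <= a) && (d <= b)).
  have -> : a = (a - c) + c by lia.
  have -> : b = (b - d) + d by lia.
  by apply: (proj2 (Pstep (a - c) (b - d) c d _ _ c0 d0 _ _)); last (apply: IH); lia.
have [h'|h'] := boolP ((a <= c) && (b <= d)).
  have -> : c = a + (c - a) by lia.
  have -> : d = b + (d - b) by lia.
  by apply: (proj1 (Pstep a b (c - a) (d - b) a0 b0 _ _ _ _)); last (apply: IH); lia.
suff : [/\ a = 1, b = 0, c = 0 & d = 1] by case=> -> -> -> ->.
have [h1|h1] := leP a c; have [h2|h2] := leP b d; try lia; first by nia.
have e1 : (c + 1) * (b + 1) <= a * d by apply: ler_pM; lia.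
split; nia.
Qed.

Section Quadrant.
Variables (R : realType) (D : R) (g : int -> int -> R).
Hypothesis gT : topograph D g.
Hypothesis g_outward : outward g 1 0 0 1.

Definition region_length (a b : int) : R := rho `|g a b|.
Local Notation f := region_length.
Definition least_root_label : R := Num.min `|g 1 0| `|g 0 1|.
Local Notation m := least_root_label.
Definition growth_rate : R := ln (m / 2).
Local Notation l := growth_rate.

Lemma outward_step a b c d : (a * d - b * c) ^+ 2 = 1 -> outward g a b c d ->
  outward g a b (a + c) (b + d) /\ outward g (a + c) (b + d) c d.
Proof.
move=> e [p h].
have e1 := topograph_edge gT (a + c) (b + d) a b.
have e2 := topograph_edge gT (a + c) (b + d) c d.
have {}e1 : g (a + (a + c)) (b + (b + d)) = g (a + c) (b + d) * g a b - g c d.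
  rewrite -e1; last by rewrite -[RHS]e; ring.
  by rewrite ![_ + (_ + _)]addrC [a + c]addrC [b + d]addrC !addrK.
have {}e2 : g (a + c + c) (b + d + d) = g (a + c) (b + d) * g c d - g a b.
  by rewrite -e2; [rewrite !addrK|rewrite -[RHS]e; ring].
split; rewrite /outward ?e1 ?e2.
- by apply: outward_pos => //; exact: topograph_gt2 gT _ _.
- have [|||||h1 h2] := @outward_pos R (g c d) (g a b) (g (a + c) (b + d)).
  + by rewrite [g c d * _]mulrC.
  + by rewrite mulrC.
  + exact: topograph_gt2 gT _ _.
  + exact: topograph_gt2 gT _ _.
  + exact: topograph_gt2 gT _ _.
  by rewrite [X in _ < X * _]mulrC [X in `|X| <= _]mulrC.
Qed.

Lemma m_gt2 : 2 < m.
Proof. by rewrite /m lt_min !(topograph_gt2 gT). Qed.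

Lemma l_gt0 : 0 < l.
Proof. by rewrite ln_gt0//; have := m_gt2; lra. Qed.

(** In other terms |g|/2 >= (m/2)^(a + b); the rate [l] is the one that gives equality at the
    smaller of the two root labels. *)
Definition big_label (a b : int) : bool := 2 * expR (l * (a + b)%:~R) <= `|g a b|.

Local Notation big := big_label.

Lemma big_ge a b : 0 <= a + b -> a + b != 0 -> big a b -> m <= `|g a b|.
Proof.
move=> ab0 ab1; apply: le_trans; rewrite -ler_pdivrMl// mulrC.
have -> : m / 2 = expR (l * 1) by rewrite mulr1 lnK// posrE; have := m_gt2; lra.
by rewrite ler_expR ler_pM2l ?l_gt0// -[1]/(1%:~R) ler_int; lia.
Qed.

Lemma big10 : big 1 0.
Proof.
rewrite /big addr0 mulr1 lnK ?posrE; last by have := m_gt2; lra.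
by rewrite mulrC divfK ?pnatr_eq0// /m ge_min lexx.
Qed.

Lemma big01 : big 0 1.
Proof.
rewrite /big add0r mulr1 lnK ?posrE; last by have := m_gt2; lra.
by rewrite mulrC divfK ?pnatr_eq0// /m ge_min lexx orbT.
Qed.

(* The logarithm of half the label is superadditive along outward edges. *)
Lemma big_step a b c d : outward g a b c d -> big a b -> big c d ->
  big (a + c) (b + d).
Proof.
move=> [_ h] h1 h2; rewrite /big.
have -> : l * (a + c + (b + d))%:~R = l * (a + b)%:~R + l * (c + d)%:~R.
  by rewrite -mulrDr -intrD addrACA.
rewrite expRD; move: h h1 h2; rewrite /big normrM.
move: (expR_gt0 (l * (a + b)%:~R)) (expR_gt0 (l * (c + d)%:~R)).
move: (expR (l * (a + b)%:~R)) (expR (l * (c + d)%:~R)) `|g a b| `|g c d| `|g (a + c) (b + d)| => x y r s t x0 y0 h h1 h2.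
have : (2 * x) * (2 * y) <= r * s by apply: ler_pM; lra.
lra.
Qed.

(** If a d - b c = 1, the linear form that agrees with [f] at (a, b) and (c, d) has coefficients
    [cross2] and [- cross1]. *)
Definition cross1 (a b c d : int) : R := f a b * c%:~R - f c d * a%:~R.
Definition cross2 (a b c d : int) : R := f a b * d%:~R - f c d * b%:~R.

(** With S = a + b + c + d, the allowance for the slopes is f 1 0 + f 0 1 at S = 2 and rises by C/S
    - C/S' when S grows to S', always staying below f 1 0 + f 0 1 + C/2. *)
Let inv (C : R) (a b c d : int) := [/\ outward g a b c d, big a b, big c d,
  `|cross1 a b c d| <= f 1 0 + f 0 1 + C / 2 - C / (a + b + c + d)%:~R &
  `|cross2 a b c d| <= f 1 0 + f 0 1 + C / 2 - C / (a + b + c + d)%:~R].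

(** Along an outward edge |g p g q| >= e^(l S) >= (l S / 3)^3, with S the sum of all coordinates.
    The third power leaves S^-2 after multiplication by S, which bounds the coordinate that
    multiplies the defect in a slope. *)
Lemma defect_bound : exists2 C : R, 0 < C & forall a b c d : int,
  0 <= a -> 0 <= b -> 0 <= c -> 0 <= d -> a * d - b * c = 1 ->
  outward g a b c d -> big a b -> big c d ->
  `|f (a + c) (b + d) - f a b - f c d| * (a + b + c + d)%:~R
    <= C / (a + b + c + d)%:~R ^+ 2.
Proof.
have [C C0 HC] := rho_almost_additive D m_gt2.
have l0 := l_gt0.
exists (C * (27 / l ^+ 3)) => [|a b c d a0 b0 c0 d0 e o h1 h2].
  by rewrite mulr_gt0// divr_gt0// exprn_gt0.
have ab1 : 1 <= a + b by clear -a0 b0 c0 d0 e; nia.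
have cd1 : 1 <= c + d by clear -a0 b0 c0 d0 e; nia.
have [s0 ab0 cd0] : [/\ 0 < a + b + c + d, a + b != 0 & c + d != 0] by clear -ab1 cd1; split; lia.
have [t0 abcd0] : 0 <= a + c + (b + d) /\ a + c + (b + d) != 0 by clear -ab1 cd1; split; lia.
have [ab0' cd0'] : 0 <= a + b /\ 0 <= c + d by clear -ab1 cd1; split; lia.
have [p q] := o.
have h3 := big_step o h1 h2.
have g1 : m <= `|g a b| by apply: big_ge.
have g2 : m <= `|g c d| by apply: big_ge.
have g3 : m <= `|g (a + c) (b + d)| by apply: big_ge.
have := HC _ _ _ g1 g2 g3; rewrite -!/(f _ _).
rewrite -normrM => /(_ _ q) h4.
have {}h4 : `|f (a + c) (b + d) - f a b - f c d| <= C / `|g a b * g c d|.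
  apply: h4; have := topograph_vertex gT a b c d.
  by rewrite e -[X in _ - X](gtr0_norm p) !normrM -!(real_normK (num_real (g _ _))); exact.
set s := a + b + c + d; set S : R := s%:~R.
have S0 : 0 < S by rewrite ltr0z.
have g4 : (l * S / 3) ^+ 3 <= `|g a b * g c d|.
  have y0 : 0 <= l * S / 3 by rewrite divr_ge0// mulr_ge0// ltW.
  have : (l * S / 3) ^+ 3 <= expR (l * S).
    have -> : expR (l * S) = expR (l * S / 3) ^+ 3.
      by rewrite -expRM_natl; congr expR; field.
    rewrite lerXn2r ?nnegrE ?expR_ge0//.
    by rewrite (le_trans _ (expR_ge1Dx _))// lerDr.
  move/le_trans; apply; rewrite normrM.
  have -> : l * S = l * (a + b)%:~R + l * (c + d)%:~R.
    by rewrite -mulrDr -intrD /S /s addrA.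
  move: h1 h2; rewrite expRD /big.
  move: (expR_gt0 (l * (a + b)%:~R)) (expR_gt0 (l * (c + d)%:~R)).
  move: (expR (l * (a + b)%:~R)) (expR (l * (c + d)%:~R)) => x y x0 {}y0 h1 h2.
  by apply: ler_pM; lra.
have y0 : 0 < (l * S / 3) ^+ 3 by rewrite exprn_gt0// divr_gt0// mulr_gt0.
rewrite (@le_trans _ _ (C / (l * S / 3) ^+ 3 * S))//.
  rewrite ler_pM2r// (le_trans h4)// ler_pM2l// lef_pV2 ?posrE//.
  exact: lt_le_trans g4.
rewrite le_eqVlt; apply/orP; left; apply/eqP; field.
by rewrite !gt_eqF.
Qed.

(** Passing to a neighbouring edge changes a slope by the defect times a coordinate of the pair.
    This is at most C/(2 S^2) <= C/S - C/(S + 1), and the coordinate sum grows by at least 1, so the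
    telescoping allowance of [inv] pays for it. *)
Lemma inv_step (C : R) a b c d : (forall a b c d : int,
  0 <= a -> 0 <= b -> 0 <= c -> 0 <= d -> a * d - b * c = 1 ->
  outward g a b c d -> big a b -> big c d ->
  `|f (a + c) (b + d) - f a b - f c d| * (a + b + c + d)%:~R
    <= C / 2 / (a + b + c + d)%:~R ^+ 2) -> 0 < C ->
  0 <= a -> 0 <= b -> 0 <= c -> 0 <= d -> a * d - b * c = 1 ->
  inv C a b c d -> inv C a b (a + c) (b + d) /\ inv C (a + c) (b + d) c d.
Proof.
move=> HC C0 a0 b0 c0 d0 e [ho h1 h2 h3 h4].
have [ho1 ho2] : outward g a b (a + c) (b + d) /\ outward g (a + c) (b + d) c d.
  by apply: outward_step; rewrite // e.
have h5 := big_step ho h1 h2.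
have := HC _ _ _ _ a0 b0 c0 d0 e ho h1 h2.
move: h3 h4; rewrite /inv /cross1 /cross2.
set x := f (a + c) (b + d).
set S : R := (a + b + c + d)%:~R.
have ab1 : 1 <= a + b by clear -a0 b0 c0 d0 e; nia.
have cd1 : 1 <= c + d by clear -a0 b0 c0 d0 e; nia.
have S1 : 1 <= S by rewrite -[1]/(1%:~R) ler_int; lia.
move=> h3 h4 h6.
have key (y z : int) (u G : R) : 0 <= y <= a + b + c + d -> a + b + c + d + 1 <= z ->
   `|u| = `|x - f a b - f c d| -> `|G| <= f 1 0 + f 0 1 + C / 2 - C / S ->
   `|G + u * y%:~R| <= f 1 0 + f 0 1 + C / 2 - C / z%:~R.
  move=> /andP[y0 yS] zS uE hG; rewrite (le_trans (ler_normD _ _))//.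
  have : `|u * y%:~R| <= C / 2 / S ^+ 2.
    rewrite normrM uE (le_trans _ h6)// ler_wpM2l// ger0_norm ?ler0z//.
    by rewrite ler_int.
  have : C / z%:~R <= C / (S + 1).
    rewrite ler_pM2l// lef_pV2 ?posrE; [|by rewrite ltr0z; lia|lra].
    by rewrite /S -[1]/(1%:~R) -intrD ler_int.
  have : C / 2 / S ^+ 2 <= C / S - C / (S + 1).
    have -> : C / S - C / (S + 1) = C / (S * (S + 1)) by field; lra.
    rewrite -mulrA ler_pM2l// -invfM lef_pV2 ?posrE; nra.
  lra.
split; split=> //.
- have -> : f a b * (a + c)%:~R - x * a%:~R
    = f a b * c%:~R - f c d * a%:~R + - (x - f a b - f c d) * a%:~R by rewrite intrD; ring.
  by apply: key; rewrite ?normrN//; lia.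
- have -> : f a b * (b + d)%:~R - x * b%:~R
    = f a b * d%:~R - f c d * b%:~R + - (x - f a b - f c d) * b%:~R by rewrite intrD; ring.
  by apply: key; rewrite ?normrN//; lia.
- have -> : x * c%:~R - f c d * (a + c)%:~R
    = f a b * c%:~R - f c d * a%:~R + (x - f a b - f c d) * c%:~R by rewrite intrD; ring.
  by apply: key; rewrite ?normrN//; lia.
- have -> : x * d%:~R - f c d * (b + d)%:~R
    = f a b * d%:~R - f c d * b%:~R + (x - f a b - f c d) * d%:~R by rewrite intrD; ring.
  by apply: key; rewrite ?normrN//; lia.
Qed.

Lemma quadrant_edge_bound : exists2 K : R, 0 < K & forall a b c d : int,
  0 <= a -> 0 <= b -> 0 <= c -> 0 <= d -> a * d - b * c = 1 ->
  [/\ big a b, big c d, `|cross1 a b c d| <= K & `|cross2 a b c d| <= K].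
Proof.
have [C C0 HC] := defect_bound.
have f10 : 0 < f 1 0 by apply: rho_gt0; exact: topograph_gt2 gT _ _.
have f01 : 0 < f 0 1 by apply: rho_gt0; exact: topograph_gt2 gT _ _.
exists (f 1 0 + f 0 1 + C) => [|a b c d a0 b0 c0 d0 e]; first by lra.
have s0 : 0 <= a + b + c + d by lia.
have : 0 <= 2 * C / (a + b + c + d)%:~R.
  by rewrite divr_ge0 ?ler0z// mulr_ge0// ltW.
have : inv (2 * C) a b c d.
  move: a b c d a0 b0 c0 d0 e {s0}; apply: quadrant_ind.
    split=> //; [exact: big10|exact: big01|..];
      rewrite (_ : (1 + 0 + 0 + 1)%:~R = 2 :> R)// /cross1 /cross2;
      by rewrite !(mulr0, mulr1, sub0r, subr0, normrN) gtr0_norm//; lra.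
  move=> a b c d a0 b0 c0 d0 e; apply: inv_step => //; last by lra.
  by have -> : 2 * C / 2 = C by field.
move=> [_ h1 h2 h3 h4] p; split=> //.
- by rewrite (le_trans h3)//; lra.
- by rewrite (le_trans h4)//; lra.
Qed.

End Quadrant.

(** * Lengths of arbitrary integer vectors *)

Lemma coprimez_decomp (a b : int) : exists d a' b' : int,
  [/\ 0 <= d, coprimez a' b', a = d * a' & b = d * b'].
Proof.
have [e|ne] := eqVneq (gcdz a b) 0.
  exists 0, 1, 0; rewrite !mul0r; split=> //; apply/eqP; move/eqP: e;
  by rewrite gcdz_eq0 => /andP[].
exists (gcdz a b), (a %/ gcdz a b)%Z, (b %/ gcdz a b)%Z.
rewrite ![gcdz a b * _]mulrC !divzK ?dvdz_gcdl ?dvdz_gcdr//; split=> //.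
rewrite /coprimez; apply/eqP/(mulfI ne); rewrite mulr1.
have := mulz_gcdr (gcdz a b) (a %/ gcdz a b)%Z (b %/ gcdz a b)%Z.
by rewrite ![gcdz a b * (_ %/ _)%Z]mulrC !divzK ?dvdz_gcdl ?dvdz_gcdr.
Qed.

Lemma coprimez_dvd1 (n a b : int) : coprimez (n * a) (n * b) -> n ^+ 2 = 1.
Proof.
move=> /coprimezP[[u v] /= e].
have {}e : n * (u * a + v * b) = 1 by rewrite -e; ring.
have : absz (n * (u * a + v * b))%R = 1%N by rewrite e.
by rewrite abszM => /eqP; rewrite muln_eq1 => /andP[/eqP h _]; nia.
Qed.

Section IntLength.
Variable R : realType.
Implicit Types g : int -> int -> R.

(** The homogeneous extension of [region_length] from primitive vectors; at the origin the factor
    gcd = 0 gives the value 0. *)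
Definition int_length g (a b : int) : R := (gcdz a b)%:~R *
  region_length g (a %/ gcdz a b)%Z (b %/ gcdz a b)%Z.

Lemma int_lengthE g (d a b : int) : 0 <= d -> coprimez a b ->
  int_length g (d * a) (d * b) = d%:~R * region_length g a b.
Proof.
move=> d0 /eqP ab1; rewrite /int_length -mulz_gcdr// ab1 mulr1.
rewrite gez0_abs//.
have [->|dn0] := eqVneq d 0; first by rewrite !mul0r.
by rewrite !mulKz.
Qed.

Lemma int_length_coprime g (a b : int) : coprimez a b ->
  int_length g a b = region_length g a b.
Proof. by move=> h; rewrite -[a in LHS]mul1r -[b in LHS]mul1r int_lengthE// mul1r. Qed.

Lemma int_lengthZ g (n a b : int) : 0 <= n ->
  int_length g (n * a) (n * b) = n%:~R * int_length g a b.
Proof.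
move=> n0; have [d [a' [b' [d0 co -> ->]]]] := coprimez_decomp a b.
rewrite [n * (d * a')]mulrA [n * (d * b')]mulrA.
by rewrite [LHS]int_lengthE ?mulr_ge0// [in RHS]int_lengthE// intrM mulrA.
Qed.

Lemma int_lengthN D g (a b : int) : topograph D g ->
  int_length g (- a) (- b) = int_length g a b.
Proof.
move=> gT; have [d [a' [b' [d0 co -> ->]]]] := coprimez_decomp a b.
rewrite -!mulrN !int_lengthE// ?/region_length ?(topograph_even gT)//.
by rewrite /coprimez gcdNz gcdzN.
Qed.

Lemma int_length_rebase g (p q r s : int) (x y : int) : (p * s - q * r) ^+ 2 = 1 ->
  int_length (rebase p q r s g) x y = int_length g (x * p + y * r) (x * q + y * s).
Proof.
move=> u; have [d [a [b [d0 co -> ->]]]] := coprimez_decomp x y.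
rewrite int_lengthE// -!mulrA -!mulrDr int_lengthE//.
move/coprimezP: co => [[m n] /= e].
set t := p * s - q * r in u *.
apply/coprimezP; exists (t * (m * s - n * q), t * (n * p - m * r)) => /=.
by rewrite -[RHS]u -[RHS]mulr1 -[in RHS]e /t; ring.
Qed.

Section Quadrant.
Variables (D : R) (g : int -> int -> R).
Hypothesis gT : topograph D g.
Hypothesis g_outward : outward g 1 0 0 1.
Local Notation f := (region_length g).

Lemma region_length_lower : exists2 c : R, 0 < c & forall a b : int,
  0 <= a -> 0 <= b -> coprimez a b -> c * (a + b)%:~R <= f a b.
Proof.
have [K K0 HK] := quadrant_edge_bound gT g_outward.
have l0 := l_gt0 gT.
exists (growth_rate g) => // a b a0 b0 co.
suff : big_label g a b.
  rewrite /big_label => h; set y := growth_rate g * _ in h *.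
  have g2 := topograph_gt2 gT a b; have [h1 h2 _ _] := growth_spec g2.
  rewrite /region_length rhoE -[y]expRK ler_ln ?posrE ?expR_gt0//; last by lra.
  by apply: le_trans h2; lra.
have [a_eq0|a_neq0] := eqVneq a 0.
  have -> : b = 1 by move: co; rewrite a_eq0 /coprimez gcd0z; lia.
  by rewrite a_eq0; have [] := HK 1 0 0 1.
have [b_eq0|b_neq0] := eqVneq b 0.
  have -> : a = 1 by move: co; rewrite b_eq0 /coprimez gcdz0; lia.
  by rewrite b_eq0; have [] := HK 1 0 0 1.
move/coprimezP: co => [[u v] /= e].
(* Bezout's relation gives the partner (- v, u) of determinant 1; adding this many copies of (a, b)
   brings it into the quadrant, as a and b are at least 1. *)
pose k : int := (absz u + absz v)%N.
have [] // := HK a b (k * a - v) (k * b + u); rewrite /k; nia.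
Qed.

(** Induction on the determinant N of p and q. For N > 1 there is r in the quadrant with det(p, r) =
    1, det(r, q) = M < N and N r = q + M p. In each coordinate, cross(p, q) r = cross(p, r) q +
    cross(r, q) p, so the bounds K and K M combine to K N. *)
Lemma region_length_cross : exists2 K : R, 0 < K & forall a b c d : int,
  0 <= a -> 0 <= b -> 0 <= c -> 0 <= d -> coprimez a b -> coprimez c d ->
  0 < a * d - b * c ->
  `|cross1 g a b c d| <= K * (a * d - b * c)%:~R /\
  `|cross2 g a b c d| <= K * (a * d - b * c)%:~R.
Proof.
have [K K0 HK] := quadrant_edge_bound gT g_outward.
exists K => //.
suff H (n : nat) : forall a b c d : int, 0 <= a -> 0 <= b -> 0 <= c -> 0 <= d ->
    coprimez a b -> coprimez c d -> 0 < a * d - b * c -> a * d - b * c <= n ->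
    `|cross1 g a b c d| <= K * (a * d - b * c)%:~R /\
    `|cross2 g a b c d| <= K * (a * d - b * c)%:~R.
  move=> a b c d a0 b0 c0 d0 ab cd n0; apply: (H (absz (a * d - b * c)%R)) => //; lia.
elim: n => [|n IH] a b c d a0 b0 c0 d0 ab cd n0 hn; first by lia.
have [e1|ne1] := eqVneq (a * d - b * c) 1.
  by rewrite e1 mulr1; have [] := HK a b c d.
set N := a * d - b * c in n0 hn ne1 *.
move/coprimezP: (ab) => [[u v] /= e].
(* Adding k copies of (a, b) to (- v, u) turns its determinant with (c, d) into a remainder modulo
   N. *)
pose k := - ((- v * d - u * c) %/ N)%Z.
pose r1 := k * a - v; pose r2 := k * b + u.
have pr : a * r2 - b * r1 = 1 by rewrite /r1 /r2 -e; ring.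
have rq : r1 * d - r2 * c = ((- v * d - u * c) %% N)%Z.
  by rewrite /modz /r1 /r2 /k /N; ring.
set M := r1 * d - r2 * c in rq.
have M0 : 0 <= M by rewrite rq modz_ge0; lia.
have MN : M < N by rewrite rq ltz_pmod.
have e3 : N * r1 = c + M * a.
  by rewrite -[c]mulr1 -pr /M /N; ring.
have e4 : N * r2 = d + M * b.
  by rewrite -[d]mulr1 -pr /M /N; ring.
have M1 : M != 0.
  apply/negP => /eqP M00; move: e3 e4; rewrite M00 !mul0r !addr0 => e3 e4.
  by move: cd; rewrite -e3 -e4 => /coprimez_dvd1; nia.
have r10 : 0 <= r1.
  by rewrite -(pmulr_rge0 _ n0) e3 addr_ge0// mulr_ge0.
have r20 : 0 <= r2.
  by rewrite -(pmulr_rge0 _ n0) e4 addr_ge0// mulr_ge0.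
have rco : coprimez r1 r2 by apply/coprimezP; exists (- b, a) => /=; rewrite -pr; ring.
have M0' : 0 < M by rewrite lt_neqAle eq_sym M1.
have [h1 h2] : `|cross1 g r1 r2 c d| <= K * M%:~R /\ `|cross2 g r1 r2 c d| <= K * M%:~R.
  by apply: IH => //; lia.
have [_ _ h3 h4] := HK a b r1 r2 a0 b0 r10 r20 pr.
have comb (x y z w1 w2 w3 : R) : 0 <= x -> 0 <= y -> 0 <= z ->
    N%:~R * z = y + M%:~R * x -> w1 * z = w2 * y + w3 * x ->
    `|w2| <= K -> `|w3| <= K * M%:~R -> (x = 0 -> y = 0 -> w1 = 0) ->
    `|w1| <= K * N%:~R.
  move=> x0 y0 z0 zE wE h5 h6 h7.
  have N0 : 0 < N%:~R :> R by rewrite ltr0z.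
  have M0r : 0 < M%:~R :> R by rewrite ltr0z.
  have [z_eq0|z_neq0] := eqVneq z 0.
    have Mx : 0 <= M%:~R * x by rewrite mulr_ge0// ltW.
    move: zE; rewrite z_eq0 mulr0 => zE.
    have xM0 : M%:~R * x = 0 by lra.
    have x_0 : x = 0 by apply/eqP; move/eqP: xM0; rewrite mulf_eq0 gt_eqF.
    rewrite h7 ?normr0 ?mulr_ge0 ?ltW//; lra.
  have zp : 0 < z by rewrite lt_neqAle eq_sym z_neq0.
  rewrite -(ler_pM2r zp) -{1}(gtr0_norm zp) -normrM wE -mulrA zE.
  rewrite (le_trans (ler_normD _ _))// !normrM (ger0_norm x0) (ger0_norm y0).
  by rewrite mulrDr lerD// ?mulrA ler_wpM2r.
split.
- apply: (comb a%:~R c%:~R r1%:~R _ (cross1 g a b r1 r2) (cross1 g r1 r2 c d)) => //.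
  + by rewrite ler0z.
  + by rewrite ler0z.
  + by rewrite ler0z.
  + by rewrite -!intrM -intrD e3.
  + by rewrite /cross1; ring.
  + by rewrite /cross1 => -> ->; rewrite !mulr0 subrr.
- apply: (comb b%:~R d%:~R r2%:~R _ (cross2 g a b r1 r2) (cross2 g r1 r2 c d)) => //.
  + by rewrite ler0z.
  + by rewrite ler0z.
  + by rewrite ler0z.
  + by rewrite -!intrM -intrD e4.
  + by rewrite /cross2; ring.
  + by rewrite /cross2 => -> ->; rewrite !mulr0 subrr.
Qed.

End Quadrant.
End IntLength.

(* [lia] after discarding the hypotheses about reals, which only slow it down. *)
Ltac zlia :=
  match goal with R : realType |- _ =>
    repeat match goal with
    | H : ?P |- _ => lazymatch type of P with Prop => idtac end;
                     match P with context [R] => clear H end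
    end
  end; lia.

Section SourceSteps.
Variable R : realType.
Implicit Types g : int -> int -> R.

Section Quadrant.
Variables (D : R) (g : int -> int -> R).
Hypothesis gT : topograph D g.
Hypothesis g_outward : outward g 1 0 0 1.
Local Notation f := (region_length g).
Local Notation N := (int_length g).

Lemma int_length_cross : exists2 K : R, 0 < K & forall a b c d : int,
  0 <= a -> 0 <= b -> 0 <= c -> 0 <= d ->
  `|N a b * c%:~R - N c d * a%:~R| <= K * `|a * d - b * c|%:~R /\
  `|N a b * d%:~R - N c d * b%:~R| <= K * `|a * d - b * c|%:~R.
Proof.
have [K K0 HK] := region_length_cross gT g_outward.
exists K => // a b c d.
have [m [a' [b' [m0 ab -> ->]]]] := coprimez_decomp a b.
have [n [c' [d' [n0 cd -> ->]]]] := coprimez_decomp c d.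
have -> : m * a' * (n * d') - m * b' * (n * c') = m * n * (a' * d' - b' * c') by ring.
rewrite !int_lengthE// normrM (ger0_norm (mulr_ge0 m0 n0)).
have [->|mn0] := eqVneq m 0.
  by rewrite !mul0r !mulr0 subrr normr0.
have [->|nn0] := eqVneq n 0.
  by rewrite !(mul0r, mulr0) subrr normr0.
have {mn0}m0 : 0 < m by lia.
have {nn0}n0 : 0 < n by lia.
rewrite !pmulr_rge0// => a0 b0 c0 d0.
have e1 : m%:~R * f a' b' * (n * c')%:~R - n%:~R * f c' d' * (m * a')%:~R
    = (m * n)%:~R * cross1 g a' b' c' d' by rewrite /cross1 !intrM; ring.
have e2 : m%:~R * f a' b' * (n * d')%:~R - n%:~R * f c' d' * (m * b')%:~R
    = (m * n)%:~R * cross2 g a' b' c' d' by rewrite /cross2 !intrM; ring.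
have mnR : 0 < (m * n)%:~R :> R by rewrite ltr0z mulr_gt0.
have -> : K * (m * n * `|a' * d' - b' * c'|)%:~R
    = (m * n)%:~R * (K * `|a' * d' - b' * c'|%:~R) by rewrite intrM mulrCA.
rewrite e1 e2 !normrM (gtr0_norm mnR) !ler_pM2l//.
have [p|p|p] := ltgtP 0 (a' * d' - b' * c').
- by rewrite (gtr0_norm p); exact: HK.
- rewrite (ltr0_norm p).
  have e : - (a' * d' - b' * c') = c' * b' - d' * a' by ring.
  have [|h1 h2] := HK c' d' a' b' c0 d0 a0 b0 cd ab; first by lia.
  rewrite e; split.
  + by rewrite -normrN (_ : - _ = cross1 g c' d' a' b')// /cross1; ring.
  + by rewrite -normrN (_ : - _ = cross2 g c' d' a' b')// /cross2; ring.
- have [h1 h2] : a' = c' /\ b' = d'.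
    move/coprimezP: ab => [[u v] /= e].
    have hc : c' = (u * c' + v * d') * a'.
      have -> : (u * c' + v * d') * a' = c' * (u * a' + v * b') + v * (a' * d' - b' * c') by ring.
      by rewrite e -p; ring.
    have hd : d' = (u * c' + v * d') * b'.
      have -> : (u * c' + v * d') * b' = d' * (u * a' + v * b') - u * (a' * d' - b' * c') by ring.
      by rewrite e -p; ring.
    move: cd hc hd c0 d0; move: (u * c' + v * d') => k cd hc hd.
    rewrite hc hd in cd *; have /eqP := coprimez_dvd1 cd; rewrite sqrf_eq1 => /orP[]/eqP ->; first by rewrite !mul1r.
    move=> c0 d0; have [a_0 b_0] : a' = 0 /\ b' = 0 by lia.
    by move: e; rewrite a_0 b_0 !mulr0.
  rewrite -p /cross1 /cross2 h1 h2 normr0 mulr0.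
  by rewrite !subrr !normr0.
Qed.

(** (a + 1, b) and (a, b) have determinant b and share the second coordinate b, so the factor b
    cancels in [int_length_cross]; on the axes [N] is linear. The diagonal step is needed because a
    unit step becomes diagonal in the basis of another edge of the source. *)
Lemma int_length_steps : exists2 K : R, 0 < K & forall a b : int, 0 <= a -> 0 <= b ->
  [/\ `|N (a + 1) b - N a b| <= K, `|N a (b + 1) - N a b| <= K
    & `|N (a + 1) b - N a (b + 1)| <= K].
Proof.
have [K K0 HK] := int_length_cross.
set M := K + `|f 1 0| + `|f 0 1|.
have h1 a b : 0 <= a -> 0 <= b -> `|N (a + 1) b - N a b| <= M.
  move=> a0 b0; have [->|bn0] := eqVneq b 0.
    have e c : 0 <= c -> N c 0 = c%:~R * f 1 0.
      by move=> c0; rewrite -[c in LHS]mulr1 -[0 in LHS](mulr0 c) int_lengthE.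
    rewrite !e ?addr_ge0// -mulrBl -intrB addrAC subrr add0r mul1r /M.
    by have := normr_ge0 (f 0 1); lra.
  have bp : 0 < b by zlia.
  have bR : 0 < b%:~R :> R by rewrite ltr0z.
  have [||||_] := HK (a + 1) b a b; [zlia..|].
  have -> : (a + 1) * b - b * a = b by ring.
  rewrite (gtr0_norm bp) -mulrBl normrM (gtr0_norm bR) ler_pM2r//.
  by have := normr_ge0 (f 0 1); have := normr_ge0 (f 1 0); rewrite /M; lra.
have h2 a b : 0 <= a -> 0 <= b -> `|N a (b + 1) - N a b| <= M.
  move=> a0 b0; have [->|an0] := eqVneq a 0.
    have e c : 0 <= c -> N 0 c = c%:~R * f 0 1.
      by move=> c0; rewrite -[c in LHS]mulr1 -[0 in LHS](mulr0 c) int_lengthE.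
    rewrite !e ?addr_ge0// -mulrBl -intrB addrAC subrr add0r mul1r /M.
    by have := normr_ge0 (f 1 0); lra.
  have ap : 0 < a by zlia.
  have aR : 0 < a%:~R :> R by rewrite ltr0z.
  have [||||+ _] := HK a (b + 1) a b; [zlia..|].
  have -> : a * b - (b + 1) * a = - a by ring.
  rewrite normrN (gtr0_norm ap) -mulrBl normrM (gtr0_norm aR) ler_pM2r//.
  by have := normr_ge0 (f 0 1); have := normr_ge0 (f 1 0); rewrite /M; lra.
exists (M + M) => [|a b a0 b0].
  by have := normr_ge0 (f 0 1); have := normr_ge0 (f 1 0); rewrite /M; lra.
have := h1 a b a0 b0; have := h2 a b a0 b0.
have := normr_ge0 (N (a + 1) b - N a b); have := normr_ge0 (N a (b + 1) - N a b).
move=> p1 p2 p3 p4; split; try lra.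
have -> : N (a + 1) b - N a (b + 1) = (N (a + 1) b - N a b) - (N a (b + 1) - N a b) by ring.
by rewrite (le_trans (ler_normB _ _))//; lra.
Qed.

Lemma int_length_lower : exists2 c : R, 0 < c & forall a b : int,
  0 <= a -> 0 <= b -> c * (a + b)%:~R <= N a b.
Proof.
have [c c0 hc] := region_length_lower gT g_outward.
exists c => // a b; have [m [a' [b' [m0 ab -> ->]]]] := coprimez_decomp a b.
rewrite int_lengthE//; have [->|mn0] := eqVneq m 0.
  by rewrite !mul0r mulr0.
have mp : 0 < m by zlia.
rewrite !pmulr_rge0// => a0 b0; rewrite -mulrDr intrM mulrCA ler_pM2l ?ltr0z//.
exact: hc.
Qed.

End Quadrant.

Section Source.
Variables (D : R) (g : int -> int -> R).
Hypothesis gT : topograph D g.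
Hypothesis g_source : source g.
Local Notation N := (int_length g).

(** The quadrants on the three edges of the source cover the half-plane a >= 0, and evenness gives
    the other half. A unit step is a unit or a diagonal step inside one of them. The rates [c2] and
    [c3] are halved because the coordinates in those bases add up to max(a, b) >= (a + b)/2. *)
Lemma source_steps : exists K c : R, [/\ 0 < K, 0 < c & forall a b : int,
  [/\ `|N (a + 1) b - N a b| <= K, `|N a (b + 1) - N a b| <= K
    & c * (`|a| + `|b|)%:~R <= N a b]].
Proof.
have [s1 s2 s3] := g_source.
have T1 : topograph D (rebase 1 0 0 (-1) g) by exact: rebase_topograph.
have T2 : topograph D (rebase 1 0 1 1 g) by exact: rebase_topograph.
have T3 : topograph D (rebase 0 1 1 1 g) by exact: rebase_topograph.
have [K1 K10 step1] := int_length_steps T1 s1.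
have [K2 K20 step2] := int_length_steps T2 s2.
have [K3 K30 step3] := int_length_steps T3 s3.
have [c1 c10 low1] := int_length_lower T1 s1.
have [c2 c20 low2] := int_length_lower T2 s2.
have [c3 c30 low3] := int_length_lower T3 s3.
have e1 a b : int_length (rebase 1 0 0 (-1) g) a b = N a (- b).
  by rewrite int_length_rebase//; congr int_length; ring.
have e2 a b : int_length (rebase 1 0 1 1 g) a b = N (a + b) b.
  by rewrite int_length_rebase//; congr int_length; ring.
have e3 a b : int_length (rebase 0 1 1 1 g) a b = N b (a + b).
  by rewrite int_length_rebase//; congr int_length; ring.
pose K := K1 + K2 + K3.
pose c := Num.min c1 (Num.min (c2 / 2) (c3 / 2)).
have [hc1 hc2 hc3] : [/\ c <= c1, c <= c2 / 2 & c <= c3 / 2].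
  by rewrite /c !ge_min !lexx !orbT.
have c0 : 0 < c by rewrite /c !lt_min c10 !divr_gt0.
exists K, c; split=> //; first by rewrite /K; lra.
have pos (P : int -> int -> Prop) : (forall a b, 0 <= a -> P a b) ->
    (forall a b, P a b -> P (- a) (- b)) -> forall a b, P a b.
  move=> h1 h2 a b; have [a0|/ltW a0] := leP 0 a; first exact: h1.
  by rewrite -[a]opprK -[b]opprK; apply/h2/h1; rewrite oppr_ge0.
have x1 (a b : int) : 0 <= a -> `|N (a + 1) b - N a b| <= K.
  move=> a0; have [b0|b0] := leP 0 b; last first.
    have [||] := step1 a (- b); [zlia..|].
    rewrite !e1 opprK => h _ _; rewrite (le_trans h)// /K; lra.
  have [ba|ab] := leP b a.
    have [||] := step2 (a - b) b; [zlia..|].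
    rewrite !e2 addrAC !subrK => h _ _; rewrite (le_trans h)// /K; lra.
  have [||] := step3 (b - a - 1) a; [zlia..|].
  rewrite !e3 (_ : b - a - 1 + 1 + a = b); last by ring.
  rewrite (_ : b - a - 1 + (a + 1) = b); last by ring.
  move=> _ _ h; rewrite distrC (le_trans h)// /K; lra.
have x2 (a b : int) : 0 <= a -> `|N a (b + 1) - N a b| <= K.
  move=> a0; have [b0|b0] := leP 0 b; last first.
    have [||] := step1 a (- b - 1); [zlia..|].
    rewrite !e1 (_ : - (- b - 1 + 1) = b); last by ring.
    rewrite (_ : - (- b - 1) = b + 1); last by ring.
    by move=> _ h _; rewrite distrC (le_trans h)// /K; lra.
  have [ab|ba] := leP a b.
    have [||] := step3 (b - a) a; [zlia..|].
    rewrite !e3 (_ : b - a + 1 + a = b + 1); last by ring.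
    rewrite subrK => h _ _; rewrite (le_trans h)// /K; lra.
  have [||] := step2 (a - b - 1) b; [zlia..|].
  rewrite !e2 (_ : a - b - 1 + 1 + b = a); last by ring.
  rewrite (_ : a - b - 1 + (b + 1) = a); last by ring.
  move=> _ _ h; rewrite distrC (le_trans h)// /K; lra.
have x3 (a b : int) : 0 <= a -> c * (`|a| + `|b|)%:~R <= N a b.
  move=> a0; have [b0|b0] := leP 0 b; last first.
    have := low1 a (- b) a0; rewrite e1 opprK => h.
    rewrite ger0_norm// ltr0_norm//; apply: le_trans (h _); last by zlia.
    by rewrite ler_pM2r ?ltr0z; [lra|zlia].
  have S0 : 0 <= (a + b)%:~R :> R by rewrite ler0z; zlia.
  have [ba|ab] := leP b a.
    have := low2 (a - b) b; rewrite e2 subrK => h.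
    rewrite !ger0_norm//; apply: le_trans (h _ _) => //; last by zlia.
    have : (a + b)%:~R <= 2 * a%:~R :> R by rewrite -[2]/(2%:~R) -intrM ler_int; zlia.
    nra.
  have := low3 (b - a) a; rewrite e3 subrK => h.
  rewrite !ger0_norm//; apply: le_trans (h _ _) => //; last by zlia.
  have : (a + b)%:~R <= 2 * b%:~R :> R by rewrite -[2]/(2%:~R) -intrM ler_int; zlia.
  nra.
move=> a b; split.
- have [a0|a0] := leP 0 a; first exact: x1.
  rewrite -(int_lengthN (a + 1) b gT) -(int_lengthN a b gT) distrC.
  by have := x1 (- (a + 1)) (- b); rewrite (_ : - (a + 1) + 1 = - a); [apply; zlia|ring].
- have [a0|a0] := leP 0 a; first exact: x2.
  rewrite -(int_lengthN a (b + 1) gT) -(int_lengthN a b gT) distrC.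
  by have := x2 (- a) (- (b + 1)); rewrite (_ : - (b + 1) + 1 = - b); [apply; zlia|ring].
- have [a0|a0] := leP 0 a; first exact: x3.
  by rewrite -(int_lengthN a b gT) -[ `|a|]normrN -[ `|b|]normrN; apply: x3; zlia.
Qed.

End Source.
End SourceSteps.

(** * The Lipschitz bound on the integer lattice *)

Section Lattice.
Variable R : realType.

Lemma int_steps_lip (h : int -> R) (K : R) : (forall n, `|h (n + 1) - h n| <= K) ->
  forall m n, `|h m - h n| <= K * `|m - n|%:~R.
Proof.
move=> hK m n; wlog mn : m n / n <= m.
  move=> H; have [/H//|/ltW/H] := leP n m.
  by rewrite distrC [X in X%:~R]distrC.
have -> : m = n + (absz (m - n)%R)%:Z by lia.
elim: (absz _) => [|k IH]; first by rewrite addr0 !subrr !normr0 mulr0.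
have -> : n + k.+1 = n + k + 1 by lia.
rewrite (le_trans (ler_distD (h (n + k)) _ _))//.
have -> : `|n + k%:Z + 1 - n| = 1 + `|n + k%:Z - n| by lia.
by rewrite intrD mulrDr mulr1 lerD.
Qed.

Lemma sum4_le (x y p q r s : int) : 0 <= x -> 0 <= y -> 0 <= p -> 0 <= q ->
  0 <= r -> 0 <= s -> x * p + y * r + (x * q + y * s) <= (p + q + r + s) * (x + y).
Proof.
move=> *; rewrite -subr_ge0 (_ : _ - _ = x * r + x * s + (y * p + y * q)); last by ring.
by rewrite !addr_ge0 ?mulr_ge0.
Qed.

(** The bounds at the source are carried back by the change of basis. A unimodular matrix and its
    inverse have the same entries up to order and sign, so one factor [M], the sum of their absolute
    values, compares the l1 norms in both directions. *)
Lemma int_length_lip (D : R) g : D <> 4 -> topograph D g ->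
  exists K c : R, [/\ 0 < K, 0 < c & forall a b a' b' : int,
    `|int_length g a b - int_length g a' b'| <= K * (`|a - a'| + `|b - b'|)%:~R /\
    c * (`|a| + `|b|)%:~R <= int_length g a b].
Proof.
move=> D4 gT; have [p [q [r [s [u src]]]]] := topograph_has_source D4 gT.
have g'T := rebase_topograph u gT.
have [K [c [K0 c0 H]]] := source_steps g'T src.
have lip (a b a' b' : int) : `|int_length (rebase p q r s g) a b
    - int_length (rebase p q r s g) a' b'| <= K * (`|a - a'| + `|b - b'|)%:~R.
  rewrite (le_trans (ler_distD (int_length (rebase p q r s g) a' b) _ _))//.
  rewrite intrD mulrDr lerD//.
  - apply: (int_steps_lip (h := fun x => int_length (rebase p q r s g) x b)) => n.
    by have [] := H n b.
  - apply: (int_steps_lip (h := fun x => int_length (rebase p q r s g) a' x)) => n.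
    by have [] := H a' n.
pose t := p * s - q * r.
(* Coordinates in the basis (p, q), (r, s); the determinant [t] is 1 or -1, hence its own
   inverse. *)
pose X a b := t * (a * s - b * r); pose Y a b := t * (b * p - a * q).
have XY a b : int_length g a b = int_length (rebase p q r s g) (X a b) (Y a b).
  rewrite int_length_rebase//; congr int_length.
    have -> : X a b * p + Y a b * r = a * t ^+ 2 by rewrite /X /Y /t; ring.
    by rewrite u mulr1.
  have -> : X a b * q + Y a b * s = b * t ^+ 2 by rewrite /X /Y /t; ring.
  by rewrite u mulr1.
pose M := `|p| + `|q| + `|r| + `|s|.
have t1 : `|t| = 1.
  by apply/eqP; rewrite -sqr_norm_eq1 u.
have XYM a b : `|X a b| + `|Y a b| <= M * (`|a| + `|b|).
  rewrite /X /Y !normrM t1 !mul1r.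
  have := ler_normB (a * s) (b * r); have := ler_normB (b * p) (a * q).
  rewrite !normrM => h1 h2; apply: le_trans (lerD h2 h1) _.
  rewrite [ `|b| * `|p| + _]addrC; apply: le_trans (sum4_le _ _ _ _ _ _) _ => //.
  by rewrite /M; lia.
have MXY a b : `|a| + `|b| <= M * (`|X a b| + `|Y a b|).
  have ea : a = X a b * p + Y a b * r.
    by rewrite (_ : _ + _ = a * t ^+ 2); [rewrite u mulr1|rewrite /X /Y /t; ring].
  have eb : b = X a b * q + Y a b * s.
    by rewrite (_ : _ + _ = b * t ^+ 2); [rewrite u mulr1|rewrite /X /Y /t; ring].
  rewrite [X in `|X| + _]ea [X in _ + `|X|]eb.
  have := ler_normD (X a b * p) (Y a b * r); have := ler_normD (X a b * q) (Y a b * s).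
  rewrite !normrM => h1 h2; apply: le_trans (lerD h2 h1) _.
  by rewrite /M; apply: sum4_le.
have M0 : 0 < M.
  have := MXY 1 0; rewrite normr1 normr0 addr0 => h.
  have : 0 <= `|X 1 0| + `|Y 1 0| by rewrite addr_ge0.
  have : 0 <= M by rewrite /M !addr_ge0.
  by move: h; clear; move: M (`|X 1 0| + `|Y 1 0|) => x y; nia.
have MR : 0 < M%:~R :> R by rewrite ltr0z.
exists (K * M%:~R), (c / M%:~R); split=> [||a b a' b']; [exact: mulr_gt0|exact: divr_gt0|].
split.
- rewrite !XY (le_trans (lip _ _ _ _))// -mulrA ler_pM2l// -intrM ler_int.
  by rewrite (_ : X a b - X a' b' = X (a - a') (b - b')) 1?(_ : Y a b - Y a' b' = Y (a - a') (b - b'))//;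
    rewrite /X /Y; ring.
- rewrite XY; have [_ _] := H (X a b) (Y a b); apply: le_trans.
  by rewrite -mulrA ler_pM2l// ler_pdivrMl// -intrM ler_int.
Qed.

End Lattice.

(** * The gauge *)

Section RealExtension.
Variables (R : realType) (N : int -> int -> R) (K c : R).
Hypotheses (K0 : 0 < K) (c0 : 0 < c).
Hypothesis N_lip : forall a b a' b' : int,
  `|N a b - N a' b'| <= K * (`|a - a'| + `|b - b'|)%:~R.
Hypothesis N_low : forall a b : int, c * (`|a| + `|b|)%:~R <= N a b.
Hypothesis N_scale : forall n a b : int, 0 <= n -> N (n * a) (n * b) = n%:~R * N a b.

(* The McShane extension of a Lipschitz function, taken over all positive real
   multiples of lattice vectors in order to be homogeneous. *)
Definition mcshane_values (x y : R) : set R := [set t | exists (s : R) (a b : int),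
  0 < s /\ t = s * N a b + K * (`|x - s * a%:~R| + `|y - s * b%:~R|)].

Definition mcshane (x y : R) : R := inf (mcshane_values x y).

(** In a competitor of the infimum, [c] pays for the size of the lattice multiple and [K] for its
    distance to (x, y); by the triangle inequality their minimum bounds the value at (x, y). *)
Let d := Num.min c K.

Let N_low' s a b : 0 < s -> d * (`|s * a%:~R| + `|s * b%:~R|) <= s * N a b.
Proof.
move=> s0; rewrite !normrM (gtr0_norm s0) -mulrDr mulrCA ler_pM2l//.
apply: le_trans (N_low a b); rewrite intrD !intr_norm ler_wpM2r ?addr_ge0//.
by rewrite /d ge_min lexx.
Qed.

Lemma mcshane_values_lb x y t : mcshane_values x y t -> d * (`|x| + `|y|) <= t.
Proof.
move=> [s [a [b [s0 ->]]]].
have d0 : 0 < d by rewrite /d lt_min c0.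
have dK : d <= K by rewrite /d ge_min lexx orbT.
have h1 : `|x| <= `|s * a%:~R| + `|x - s * a%:~R|.
  by rewrite -{1}(subrK (s * a%:~R) x) addrC ler_normD.
have h2 : `|y| <= `|s * b%:~R| + `|y - s * b%:~R|.
  by rewrite -{1}(subrK (s * b%:~R) y) addrC ler_normD.
have := N_low' a b s0.
have := normr_ge0 (x - s * a%:~R); have := normr_ge0 (y - s * b%:~R).
move: `|x - _| `|y - _| `|s * a%:~R| `|s * b%:~R| (s * N a b) h1 h2.
move: `|x| `|y| => X Y u v p q w h1 h2 v0 u0 h3.
have : d * (X + Y) <= d * (p + q) + d * (u + v) by rewrite -mulrDr ler_pM2l//; lra.
have : d * (u + v) <= K * (u + v) by rewrite ler_wpM2r//; lra.
lra.
Qed.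

Lemma mcshane_values_has_inf x y : has_inf (mcshane_values x y).
Proof.
split; last by exists (d * (`|x| + `|y|)) => t /mcshane_values_lb.
by exists (1 * N 0 0 + K * (`|x - 1 * 0%:~R| + `|y - 1 * 0%:~R|)), 1, 0, 0.
Qed.

Lemma mcshane_le x y t : mcshane_values x y t -> mcshane x y <= t.
Proof. by move=> h; apply: ge_inf => //; have [] := mcshane_values_has_inf x y. Qed.

Lemma mcshane_ge x y z : (forall t, mcshane_values x y t -> z <= t) -> z <= mcshane x y.
Proof. by move=> h; apply: lb_le_inf => //; have [] := mcshane_values_has_inf x y. Qed.

Lemma mcshane_lower x y : d * (`|x| + `|y|) <= mcshane x y.
Proof. by apply: mcshane_ge => t /mcshane_values_lb. Qed.

(** A real multiple s of a lattice vector must not undercut [N a b]. Scaling by n and rounding s n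
    down to an integer m reduces this to the Lipschitz bound between lattice points. The rounding
    error [C] does not depend on n, so a strict gap, multiplied by n, would exceed it. *)
Lemma mcshane_int (a b : int) : mcshane a%:~R b%:~R = N a b.
Proof.
apply/eqP; rewrite eq_le; apply/andP; split.
  apply: mcshane_le; exists 1, a, b; split=> //.
  by rewrite !mul1r !subrr !normr0 addr0 mulr0 addr0.
apply: mcshane_ge => t [s [a' [b' [s0 ->]]]].
set rhs := _ + _; rewrite leNgt; apply/negP => lt_rhs.
set C := K * (`|a'%:~R| + `|b'%:~R|) : R.
have key (n : nat) : n%:R * (N a b - rhs) <= C.
  pose m := Num.floor (s * n%:R).
  have m0 : 0 <= m by rewrite floor_ge0 mulr_ge0// ltW.
  have ms : m%:~R <= s * n%:R by exact: floor_le_tmp.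
  have sm : s * n%:R < m%:~R + 1 by rewrite -[1]/(1%:~R) -intrD; exact: floorD1_gt.
  have := N_lip (n%:Z * a) (n%:Z * b) (m * a') (m * b').
  rewrite !N_scale// => /ler_normlP[_].
  have dist (u u' : int) : `|n%:Z * u - m * u'|%:~R
      <= n%:R * `|u%:~R - s * u'%:~R| + `|u'%:~R| :> R.
    rewrite intr_norm intrB !intrM.
    have -> : n%:~R * u%:~R - m%:~R * u'%:~R
       = n%:R * (u%:~R - s * u'%:~R) + (s * n%:R - m%:~R) * u'%:~R :> R.
      by rewrite -pmulrn; ring.
    rewrite (le_trans (ler_normD _ _))// !normrM (ger0_norm (ler0n _ n)) lerD2l.
    rewrite -[X in _ <= X]mul1r ler_wpM2r// ger0_norm ?subr_ge0//; lra.
  have := dist a a'; have := dist b b'.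
  have : m%:~R * N a' b' <= s * n%:R * N a' b'.
    rewrite ler_wpM2r//; apply: le_trans (N_low a' b').
    by rewrite mulr_ge0 ?(ltW c0)// ler0z addr_ge0.
  rewrite [X in K * X]intrD -pmulrn /rhs /C.
  move: (`|n%:Z * a - m * a'|%:~R) (`|n%:Z * b - m * b'|%:~R) => u v h1 h2 h3 h4.
  have : K * (u + v) <= K * (n%:R * `|a%:~R - s * a'%:~R| + `|a'%:~R|
           + (n%:R * `|b%:~R - s * b'%:~R| + `|b'%:~R|)).
    by rewrite ler_pM2l// lerD.
  lra.
have r0 : 0 < N a b - rhs by rewrite subr_gt0.
have C0 : 0 <= C by rewrite mulr_ge0 ?addr_ge0// ltW.
have := archi_boundP (divr_ge0 C0 (ltW r0)).
by rewrite ltNge ler_pdivlMr// key.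
Qed.

Lemma mcshane_lip x y x' y' :
  `|mcshane x y - mcshane x' y'| <= K * (`|x - x'| + `|y - y'|).
Proof.
have half u v u' v' : mcshane u v <= mcshane u' v' + K * (`|u - u'| + `|v - v'|).
  rewrite -lerBlDr; apply: mcshane_ge => t [s [a [b [s0 ->]]]].
  rewrite lerBlDr; apply: (@le_trans _ _ (s * N a b + K * (`|u - s * a%:~R| + `|v - s * b%:~R|))).
    by apply: mcshane_le; exists s, a, b.
  rewrite -addrA lerD2l -mulrDr ler_pM2l//.
  have := ler_distD u' u (s * a%:~R); have := ler_distD v' v (s * b%:~R); lra.
have := half x y x' y'; have := half x' y' x y.
rewrite (distrC x' x) (distrC y' y) => h1 h2.
by apply/ler_normlP; split; lra.
Qed.

Lemma mcshane_scale s x y : 0 < s -> mcshane (s * x) (s * y) = s * mcshane x y.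
Proof.
have half u x' y' : 0 < u -> u * mcshane x' y' <= mcshane (u * x') (u * y').
  move=> u0; apply: mcshane_ge => t [r [a [b [r0 ->]]]].
  rewrite -ler_pdivlMl//; apply: mcshane_le; exists (u^-1 * r), a, b.
  split; first by rewrite mulr_gt0// invr_gt0.
  have e (z w : R) : `|z - u^-1 * r * w| = u^-1 * `|u * z - r * w|.
    rewrite -{2}(gtr0_norm (_ : 0 < u^-1)) ?invr_gt0// -normrM; congr `|_|.
    by field; rewrite gt_eqF.
  by rewrite !e; ring.
move=> s0; apply/eqP; rewrite eq_le half// andbT.
have s'0 : 0 < s^-1 by rewrite invr_gt0.
have := half _ (s * x) (s * y) s'0.
by rewrite !mulrA !mulVf ?gt_eqF// !mul1r ler_pdivrMl.
Qed.

End RealExtension.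

(** * The polar curve *)

Section Polar.
Variable R : realType.

Lemma periodic_int (T : Type) (f : R -> T) (p : R) : (forall t, f (t + p) = f t) ->
  forall (k : int) t, f (t + p * k%:~R) = f t.
Proof.
move=> per; elim/int_ind => [t|n IH t|n IH t].
- by rewrite mulr0 addr0.
- have -> : t + p * n.+1%:~R = t + p * n%:~R + p.
    by rewrite -addn1 PoszD intrD mulrDr mulr1 addrA.
  by rewrite per IH.
- rewrite -[in LHS]per -[RHS]IH; congr f.
  by rewrite -addn1 PoszD opprD intrD; ring.
Qed.

Lemma angle_unique (t u : R) : cos t = cos u -> sin t = sin u ->
  exists k : int, u = t + 2 * pi * k%:~R.
Proof.
move=> ec es; pose k := Num.floor ((u - t) / (2 * pi)).
have p0 : 0 < 2 * pi :> R by rewrite mulr_gt0// pi_gt0.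
exists k; pose y := u - t - 2 * pi * k%:~R.
suff : y = 0 by rewrite /y; lra.
have y0 : 0 <= y.
  rewrite /y subr_ge0 -ler_pdivlMl// mulrC; exact: floor_le_tmp.
have y1 : y < 2 * pi.
  have := floorD1_gt ((u - t) / (2 * pi)); rewrite -/k ltr_pdivrMr// intrD /y.
  lra.
have cosper x : cos (x + 2 * pi) = cos x :> R by rewrite mulr_natl cosD2pi.
have cy : cos y = 1.
  have -> : y = u - t + 2 * pi * (- k)%:~R by rewrite /y rmorphN; ring.
  rewrite (periodic_int cosper) cosB -ec -es -!expr2; exact: cos2Dsin2.
apply/eqP/negPn/negP => yn0.
have yp : 0 < y by rewrite lt_neqAle eq_sym yn0.
have : 0 < sin (y / 2) by apply: sin_gt0_pi; apply/andP; split; lra.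
move=> s0; have : cos y < 1; last by rewrite cy ltxx.
have -> : y = (y / 2) *+ 2 by rewrite mulr2n; lra.
rewrite cos_mulr2n mulr2n cos2sin2.
have : 0 < sin (y / 2) ^+ 2 by rewrite exprn_gt0.
lra.
Qed.

Lemma polar_coordinates (x y : R) : exists r t : R,
  [/\ 0 <= r, x = r * cos t & y = r * sin t].
Proof.
pose r := Num.sqrt (x ^+ 2 + y ^+ 2).
have r2 : r ^+ 2 = x ^+ 2 + y ^+ 2 by rewrite sqr_sqrtr// addr_ge0 ?sqr_ge0.
have r0 : 0 <= r by exact: sqrtr_ge0.
have [r_eq0|r_neq0] := eqVneq r 0.
  exists 0, 0; rewrite !mul0r; split=> //; apply/eqP; rewrite -sqrf_eq0 eq_le sqr_ge0 andbT;
  by have := sqr_ge0 x; have := sqr_ge0 y; move: r2; rewrite r_eq0; lra.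
have rp : 0 < r by rewrite lt_neqAle eq_sym r_neq0.
have cs : (x / r) ^+ 2 + (y / r) ^+ 2 = 1.
  by rewrite !expr_div_n -mulrDl -r2 mulfV// expf_neq0.
have x1 : -1 <= x / r <= 1.
  rewrite -ler_norml -(@ler_sqr _ `|_|) ?nnegrE// real_normK ?num_real// expr1n.
  by have := sqr_ge0 (y / r); lra.
have sE : Num.sqrt (1 - (x / r) ^+ 2) = `|y / r|.
  by rewrite (_ : 1 - _ = (y / r) ^+ 2); [rewrite sqrtr_sqr|lra].
have xE : x = r * (x / r) by field.
have yE : y = r * (y / r) by field.
have [y0|y0] := leP 0 (y / r).
- exists r, (acos (x / r)); split=> //; first by rewrite acosK.
  by rewrite sin_acos// sE ger0_norm.
- exists r, (- acos (x / r)); split=> //; first by rewrite cosN acosK.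
  by rewrite sinN sin_acos// sE ltr0_norm// opprK.
Qed.

(** Rounding M (cos t, sin t) to a lattice point leaves [det] at most 2 while [dot] grows with M.
    These are the sine and the cosine, times the norm [r], of the angle [x] between the two
    directions, so [x] is small. *)
Lemma rational_angle_dense (t e : R) : 0 < e -> exists u l : R, exists a b : int,
  [/\ `|u - t| < e, 0 < l, coprimez a b, cos u = l * a%:~R & sin u = l * b%:~R].
Proof.
move=> e0.
have asin0 : asin (0 : R) = 0.
  rewrite -[X in asin X](sin0 R) sinK// in_itv/=; have := pi_gt0 R; lra.
have /cvgrPdist_lt/(_ e e0) : {for 0, continuous (@asin R)}.
  by apply: continuous_asin; rewrite ltr01 ltrN10.
rewrite asin0 => /nbhs_ballP[d /= d0 Hd].
set C := cos t; set S := sin t.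
have CS : C ^+ 2 + S ^+ 2 = 1 by exact: cos2Dsin2.
have C1 : `|C| <= 1 by exact: cos_max.
have S1 : `|S| <= 1 by exact: sin_max.
(* Chosen so that [M - 2] is positive and 2/(M - 2) < d, which puts |det / r| below [d]. *)
pose M : R := 4 + 2 / d.
have d2 : 0 < 2 / d by rewrite divr_gt0.
pose a0 := Num.floor (M * C); pose b0 := Num.floor (M * S).
pose al := M * C - a0%:~R; pose be := M * S - b0%:~R.
have floor01 (x : R) : 0 <= x - (Num.floor x)%:~R <= 1.
  have := floor_le_tmp x; have := floorD1_gt x; rewrite intrD => h1 h2.
  by apply/andP; split; lra.
have /andP[al0 al1] : 0 <= al <= 1 by exact: floor01.
have /andP[be0 be1] : 0 <= be <= 1 by exact: floor01.
have aE : a0%:~R = M * C - al by rewrite /al; ring.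
have bE : b0%:~R = M * S - be by rewrite /be; ring.
pose det := C * b0%:~R - S * a0%:~R; pose dot := C * a0%:~R + S * b0%:~R.
have absle (z w : R) : `|z| <= 1 -> 0 <= w <= 1 -> `|z * w| <= 1.
  move=> z1 /andP[w0 w1]; rewrite normrM (ger0_norm w0) -[X in _ <= X]mulr1.
  by rewrite ler_pM.
have detE : det = S * al - C * be by rewrite /det aE bE; ring.
have dotE : dot = M - (C * al + S * be).
  rewrite /dot aE bE -[in RHS](mulr1 M) -CS; ring.
have det2 : `|det| <= 2.
  rewrite detE (le_trans (ler_normB _ _))//.
  have := absle S al S1; have := absle C be C1; rewrite al0 al1 be0 be1 => /(_ isT) h /(_ isT) h'.
  lra.
have dotM : M - 2 <= dot.
  rewrite dotE lerD2l lerN2.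
  have := absle C al C1; have := absle S be S1; rewrite al0 al1 be0 be1 => /(_ isT) h /(_ isT) h'.
  by have := ler_norm (C * al); have := ler_norm (S * be); lra.
have dot0 : 0 < dot by rewrite /M in dotM; lra.
pose r := Num.sqrt (det ^+ 2 + dot ^+ 2).
have r2 : r ^+ 2 = det ^+ 2 + dot ^+ 2 by rewrite sqr_sqrtr// addr_ge0 ?sqr_ge0.
have r0 : 0 < r by rewrite sqrtr_gt0 ltr_wpDl ?sqr_ge0// exprn_gt0.
have dotr : dot <= r.
  by rewrite -ler_sqr ?nnegrE ?(ltW r0) ?(ltW dot0)// r2 lerDr sqr_ge0.
have z1 : `|det / r| <= 1.
  rewrite normrM normfV (gtr0_norm r0) ler_pdivrMr// mul1r.
  by rewrite -ler_sqr ?nnegrE ?(ltW r0)// real_normK ?num_real// r2 lerDl sqr_ge0.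
have z1' : -1 <= det / r <= 1 by rewrite -ler_norml.
pose x := asin (det / r).
have sx : sin x = det / r by rewrite /x asinK.
have cx : cos x = dot / r.
  rewrite /x cos_asin// (_ : 1 - _ = (dot / r) ^+ 2).
    by rewrite sqrtr_sqr gtr0_norm// divr_gt0.
  have -> : 1 = r ^+ 2 / r ^+ 2 by rewrite mulfV// expf_neq0 ?gt_eqF.
  by rewrite !expr_div_n -mulrBl r2 addrC addKr.
have [m [a [b [m0 co ea eb]]]] := coprimez_decomp a0 b0.
have m1 : 0 < m.
  rewrite lt_neqAle eq_sym m0 andbT; apply/eqP => m_0; move: dot0.
  by rewrite /dot ea eb m_0 !mul0r !mulr0 addr0 ltxx.
exists (t + x), (m%:~R / r), a, b; split=> //.
- rewrite addrAC subrr add0r; have := Hd (det / r); rewrite sub0r normrN; apply.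
  rewrite /ball /= sub0r normrN normrM normfV (gtr0_norm r0) ltr_pdivrMr//.
  rewrite (le_lt_trans det2)// (lt_le_trans (_ : 2 < d * (M - 2)))//.
    by rewrite /M mulrBr mulrDr mulrCA mulfV ?gt_eqF//; lra.
  by rewrite ler_pM2l//; lra.
- by rewrite divr_gt0// ltr0z.
- rewrite cosD sx cx -/C -/S mulrAC -intrM -ea.
  have -> : C * (dot / r) - S * (det / r) = (C ^+ 2 + S ^+ 2) * a0%:~R / r.
    by rewrite /dot /det; field; rewrite gt_eqF.
  by rewrite CS mul1r.
- rewrite sinD sx cx -/C -/S mulrAC -intrM -eb.
  have -> : S * (dot / r) + C * (det / r) = (C ^+ 2 + S ^+ 2) * b0%:~R / r.
    by rewrite /dot /det; field; rewrite gt_eqF.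
  by rewrite CS mul1r.
Qed.

End Polar.

Record gauge (R : realType) (K c : R) (E : R -> R -> R) : Prop := Gauge {
  gauge_lip_gt0 : 0 < K;
  gauge_low_gt0 : 0 < c;
  gauge_lip : forall x y x' y', `|E x y - E x' y'| <= K * (`|x - x'| + `|y - y'|);
  gauge_scale : forall s x y, 0 < s -> E (s * x) (s * y) = s * E x y;
  gauge_low : forall x y, c * (`|x| + `|y|) <= E x y
}.

Section GaugePolar.
Variables (R : realType) (K c : R) (E : R -> R -> R).
Hypothesis gE : gauge K c E.

Definition gauge_radius (t : R) : R := (E (cos t) (sin t))^-1.

Lemma gauge00 : E 0 0 = 0.
Proof. by have := gauge_scale gE 0 0 (ltr0n R 2); rewrite !mulr0; lra. Qed.

Lemma gauge_gt0 x y : x != 0 \/ y != 0 -> 0 < E x y.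
Proof.
move=> h; apply: lt_le_trans (gauge_low gE x y).
rewrite mulr_gt0 ?(gauge_low_gt0 gE)//.
by case: h; rewrite -normr_gt0 => ?; [rewrite ltr_wpDr|rewrite ltr_wpDl].
Qed.

Lemma gauge_dir_gt0 t : 0 < E (cos t) (sin t).
Proof.
apply: gauge_gt0; have [c0|] := eqVneq (cos t) 0; last by left.
right; apply/eqP => s0; have := cos2Dsin2 t.
by rewrite c0 s0 expr0n addr0 => /esym/eqP; rewrite oner_eq0.
Qed.

Lemma gauge_radius_gt0 t : 0 < gauge_radius t.
Proof. by rewrite invr_gt0 gauge_dir_gt0. Qed.

Lemma continuous_gauge_radius : continuous gauge_radius.
Proof.
move=> t; apply: cvgV; first by rewrite gt_eqF ?gauge_dir_gt0.
apply/cvgrPdist_lt => e e0.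
have K0 := gauge_lip_gt0 gE; pose d := e / (2 * K).
have d0 : 0 < d by rewrite divr_gt0 ?mulr_gt0.
have /cvgrPdist_lt/(_ d d0) hc := @continuous_cos R t.
have /cvgrPdist_lt/(_ d d0) hs := @continuous_sin R t.
near=> u; rewrite (le_lt_trans (gauge_lip gE _ _ _ _))//.
have h1 : `|cos t - cos u| < d by near: u.
have h2 : `|sin t - sin u| < d by near: u.
have -> : e = K * (d + d) by rewrite /d; field; rewrite gt_eqF.
by rewrite ltr_pM2l// ltrD.
Unshelve. all: by end_near.
Qed.

Lemma gauge_radius_point t l (a b : R) : 0 < l -> cos t = l * a -> sin t = l * b ->
  (a / E a b, b / E a b) = (gauge_radius t * cos t, gauge_radius t * sin t).
Proof.
move=> l0 ca sb; have E0 : E a b != 0.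
  by have := gauge_dir_gt0 t; rewrite ca sb (gauge_scale gE)// pmulr_rgt0// => /lt0r_neq0.
rewrite /gauge_radius ca sb (gauge_scale gE)//.
by congr (_, _); field; rewrite E0 gt_eqF.
Qed.

Variable P : set (R * R).
Hypothesis PE : forall p, P p <-> exists a b : int, coprimez a b /\
  p = (a%:~R / E a%:~R b%:~R, b%:~R / E a%:~R b%:~R).

Lemma gauge_polar_extension : polar_extension P gauge_radius.
Proof.
split.
- exact: continuous_gauge_radius.
- by move=> t; rewrite /gauge_radius mulr_natl cosD2pi sinD2pi.
- exact: gauge_radius_gt0.
- move=> p /PE[a [b [co ->]]].
  have [r [t [r0 ar br]]] := polar_coordinates (a%:~R : R) b%:~R.
  have rp : 0 < r.
    rewrite lt_neqAle eq_sym r0 andbT; apply/eqP => r_0.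
    move: ar br; rewrite r_0 !mul0r => /eqP; rewrite intr_eq0 => /eqP a0 /eqP.
    by rewrite intr_eq0 => /eqP b0; move: co; rewrite a0 b0.
  exists t; apply: (@gauge_radius_point t r^-1); first by rewrite invr_gt0.
  + by rewrite ar mulKf// gt_eqF.
  + by rewrite br mulKf// gt_eqF.
Qed.

(** Two points with positive radii coincide only if the radii agree and the angles differ by a
    multiple of 2 pi, so by periodicity [P] fixes the radius in every rational direction. These
    directions are dense and both radii are continuous. *)
Lemma gauge_radius_unique rad : polar_extension P rad -> gauge_radius = rad.
Proof.
move=> [rad_c rad_per rad_gt0 Prad].
have rat u l (a b : int) : 0 < l -> coprimez a b -> cos u = l * a%:~R ->
    sin u = l * b%:~R -> rad u = gauge_radius u.
  move=> l0 co cu su.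
  have /Prad[t] : P (a%:~R / E a%:~R b%:~R, b%:~R / E a%:~R b%:~R).
    by apply/PE; exists a, b.
  rewrite (gauge_radius_point l0 cu su) => -[hc hs].
  have g0 := gauge_radius_gt0 u; have r0 := rad_gt0 t.
  have er : gauge_radius u = rad t.
    apply/eqP; rewrite -(@eqrXn2 _ 2) ?ltW//; apply/eqP.
    rewrite -[LHS]mulr1 -[RHS]mulr1 -{1}(cos2Dsin2 u) -(cos2Dsin2 t).
    by rewrite !mulrDr -!exprMn hc hs.
  have [k ku] : exists k : int, u = t + 2 * pi * k%:~R.
    apply: angle_unique; apply: (mulfI (lt0r_neq0 r0)).
      by rewrite -hc er.
    by rewrite -hs er.
  by rewrite er ku (periodic_int rad_per).
apply/funext => t; apply/eqP/negPn/negP => ne.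
pose h := fun u => gauge_radius u - rad u.
have hc : continuous h.
  by move=> u; apply: cvgB; [exact: continuous_gauge_radius|exact: rad_c].
have ht0 : 0 < `|h t| by rewrite normr_gt0 subr_eq0.
have /cvgrPdist_lt/(_ _ ht0)/nbhs_ballP[d /= d0 Hd] := hc t.
have [u [l [a [b [ut l0 co cu su]]]]] := rational_angle_dense t d0.
have : `|h t - h u| < `|h t| by apply: Hd; rewrite /ball /= distrC.
by rewrite {2}/h (rat u l a b)// subrr subr0 ltxx.
Qed.

Lemma gauge_ball : polar_ball gauge_radius = [set p | E p.1 p.2 <= 1].
Proof.
apply/seteqP; split => [p [r [t [/andP[r0 rt] ->]]] /=|[x y] /= h].
  move: r0; rewrite le_eqVlt => /orP[/eqP <-|rp].
    by rewrite !mul0r gauge00.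
  by rewrite (gauge_scale gE)// -ler_pdivlMr ?gauge_dir_gt0// div1r.
have [r [t [r0 xE yE]]] := polar_coordinates x y.
exists r, t; split; last by rewrite xE yE.
rewrite r0 /=; move: r0; rewrite le_eqVlt => /orP[/eqP <-|rp].
  exact/ltW/gauge_radius_gt0.
move: h; rewrite xE yE (gauge_scale gE)// -ler_pdivlMr ?gauge_dir_gt0//.
by rewrite div1r.
Qed.

End GaugePolar.

(** * Area and lattice points *)

Section GaugeArea.
Variables (R : realType) (K c : R) (E : R -> R -> R).
Hypothesis gE : gauge K c E.

Definition lattice_points (T : R) : set (int * int) :=
  [set u | E u.1%:~R u.2%:~R <= T].

Lemma finite_int_box (n : nat) :
  finite_set [set u : int * int | (`|u.1| <= n%:Z) && (`|u.2| <= n%:Z)].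
Proof.
pose s := [seq (i%:Z - n%:Z, j%:Z - n%:Z) | i <- iota 0 (n + n).+1, j <- iota 0 (n + n).+1].
apply: sub_finite_set (finite_seq s) => -[a b] /= /andP[an bn].
apply/allpairsP; exists (absz (a + n)%R, absz (b + n)%R).
by rewrite !mem_iota; split=> /=; [lia|lia|congr (_, _); lia].
Qed.

Lemma finite_lattice_points T : finite_set (lattice_points T).
Proof.
have c0 := gauge_low_gt0 gE.
pose n := Num.bound (T / c).
apply: sub_finite_set (finite_int_box n) => -[a b] /= h.
have {}h := le_trans (gauge_low gE _ _) h.
have hn : T / c <= n%:R.
  have [Tc|Tc] := leP 0 (T / c); first by rewrite ltW// archi_boundP.
  by rewrite (le_trans (ltW Tc))// ler0n.
move: h; rewrite -ler_pdivlMl// mulrC => /le_trans/(_ hn) h.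
have := normr_ge0 (a%:~R : R); have := normr_ge0 (b%:~R : R).
by rewrite -!(ler_int R) !intr_norm -pmulrn => *; apply/andP; split; lra.
Qed.

Definition lattice_count (T : R) : R := #|` fset_set (lattice_points T)|%:R.

Local Notation mu := (@lebesgue_measure R \x @lebesgue_measure R)%E.

Definition cell (h : R) (u : int * int) : set (R * R) :=
  `[h * u.1%:~R, h * (u.1%:~R + 1)[%classic `*` `[h * u.2%:~R, h * (u.2%:~R + 1)[%classic.

Lemma measurable_cell h u : measurable (cell h u : set (measurableTypeR R * measurableTypeR R)).
Proof. by apply: measurableX; exact: measurable_itv. Qed.

Lemma measure_cell h u : 0 < h -> mu (cell h u) = (h ^+ 2)%:E.
Proof.
move=> h0; rewrite product_measure1E; [|exact: measurable_itv..].
have side (x : R) : lebesgue_measure `[h * x, h * (x + 1)[%classic = h%:E.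
  rewrite lebesgue_measure_itv /= lte_fin ltr_pM2l// ltrDl ltr01.
  by rewrite -EFinB; congr (_%:E); ring.
by rewrite expr2 EFinM; congr (_ * _)%E; exact: side.
Qed.

Lemma cell_floor h x y : 0 < h -> cell h (Num.floor (x / h), Num.floor (y / h)) (x, y).
Proof.
move=> h0; have side (z : R) : h * (Num.floor (z / h))%:~R <= z < h * ((Num.floor (z / h))%:~R + 1).
  have -> : (Num.floor (z / h))%:~R + 1 = (Num.floor (z / h) + 1)%:~R :> R by rewrite intrD.
  by rewrite -ler_pdivlMl// mulrC floor_le_tmp /= -ltr_pdivrMl// mulrC floorD1_gt.
by split; rewrite /= in_itv /= side.
Qed.

Lemma trivIset_cell h D : 0 < h -> trivIset D (cell h).
Proof.
move=> h0 [a b] [a' b'] _ _ [[x y] [[/= xa yb] [/= xa' yb']]].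
have eqf (z : R) (m m' : int) : z \in `[h * m%:~R, h * (m%:~R + 1)[ ->
    z \in `[h * m'%:~R, h * (m'%:~R + 1)[ -> m = m'.
  rewrite !in_itv /= => /andP[h1 h2] /andP[h3 h4].
  have := le_lt_trans h1 h4; have := le_lt_trans h3 h2.
  rewrite !ltr_pM2l// -[1]/(1%:~R) -!intrD !ltr_int; lia.
by rewrite (eqf x a a')// (eqf y b b').
Qed.

Lemma measure_cells h (S : set (int * int)) : 0 < h -> finite_set S ->
  mu (\bigcup_(u in S) cell h u) = (#|` fset_set S|%:R * h ^+ 2)%:E.
Proof.
move=> h0 fS; rewrite measure_fin_bigcup//.
- rewrite (eq_fsbigr (fun=> (h ^+ 2)%:E)); last by move=> u _; exact: measure_cell.
  rewrite fsbig_finite//= sumEFin; congr (_%:E).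
  by rewrite big_const_seq count_predT iter_addr addr0 mulr_natl.
- exact: trivIset_cell.
- by move=> u _; exact: measurable_cell.
Qed.

Local Notation B := [set p : R * R | E p.1 p.2 <= 1].

Lemma gauge_cell (T : R) u x y : 0 < T -> cell T^-1 u (x, y) ->
  `|E u.1%:~R u.2%:~R - T * E x y| <= 2 * K.
Proof.
move=> T0 [/=]; rewrite !in_itv /= => /andP[x1 x2] /andP[y1 y2].
rewrite -(gauge_scale gE)// (le_trans (gauge_lip gE _ _ _ _))//.
have side (z w : R) : T^-1 * w <= z -> z < T^-1 * (w + 1) -> `|w - T * z| <= 1.
  move=> h1 h2; have h3 : w <= T * z by rewrite -ler_pdivrMl.
  have h4 : T * z < w + 1 by rewrite -ltr_pdivlMl.
  by apply/ler_normlP; split; lra.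
rewrite [2 * K]mulrC ler_pM2l ?(gauge_lip_gt0 gE)//.
by have := side _ _ x1 x2; have := side _ _ y1 y2; lra.
Qed.

Lemma ball_sub_cells (T : R) : 0 < T ->
  B `<=` \bigcup_(u in lattice_points (T + 2 * K)) cell T^-1 u.
Proof.
move=> T0 [x y] /= xy; have T'0 : 0 < T^-1 by rewrite invr_gt0.
have := cell_floor x y T'0; set u := (_, _) => xyu.
exists u => //; have := gauge_cell T0 xyu.
rewrite /lattice_points /= => /ler_normlP[_].
have : T * E x y <= T by rewrite -[X in _ <= X]mulr1 ler_pM2l.
by lra.
Qed.

Lemma cells_sub_ball (T : R) : 0 < T ->
  \bigcup_(u in lattice_points (T - 2 * K)) cell T^-1 u `<=` B.
Proof.
move=> T0 [x y] [u /= hu /(gauge_cell T0) /ler_normlP[h _]] /=.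
by rewrite -(ler_pM2l T0) mulr1; rewrite /lattice_points /= in hu; lra.
Qed.

(** A point in the covering cells of scale n + 1 satisfies E <= 1 + 4 K / (n + 1). The intersection
    over n is therefore exactly the ball, built from countably many squares. *)
Lemma measurable_gauge_ball : measurable (B : set (measurableTypeR R * measurableTypeR R)).
Proof.
suff -> : B = \bigcap_(n in [set: nat])
    \bigcup_(u in lattice_points (n.+1%:R + 2 * K)) cell n.+1%:R^-1 u.
  apply: bigcap_measurable => [|n _]; first by exists 0%N.
  apply: fin_bigcup_measurable; first exact: finite_lattice_points.
  by move=> u _; exact: measurable_cell.
apply/seteqP; split=> [p Bp n _|[x y] h /=]; first exact: ball_sub_cells.
rewrite leNgt; apply/negP => xy1.
have K0 := gauge_lip_gt0 gE.
pose n := Num.bound (4 * K / (E x y - 1)).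
have d0 : 0 < E x y - 1 by rewrite subr_gt0.
have := archi_boundP (divr_ge0 (mulr_ge0 (ler0n R 4) (ltW K0)) (ltW d0)).
rewrite -/n ltr_pdivrMr// => hn.
have [u /= hu /(gauge_cell (ltr0Sn R n))/ler_normlP[h1 _]] := h n I.
rewrite /lattice_points /= in hu.
by rewrite -natr1 in h1 hu; nra.
Qed.

Local Notation A := (area B).

Lemma gauge_area_ge0 : 0 <= A.
Proof. by rewrite /area fine_ge0. Qed.

Lemma gauge_areaE (T : R) : 0 < T ->
  lattice_count (T - 2 * K) <= A * T ^+ 2 /\ A * T ^+ 2 <= lattice_count (T + 2 * K).
Proof.
move=> T0; have T'0 : 0 < T^-1 by rewrite invr_gt0.
have mcells S : finite_set S -> measurable
    (\bigcup_(u in S) cell T^-1 u : set (measurableTypeR R * measurableTypeR R)).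
  by move=> fS; apply: fin_bigcup_measurable => // u _; exact: measurable_cell.
have up : (mu B <= (lattice_count (T + 2 * K) * T^-1 ^+ 2)%:E)%E.
  rewrite -measure_cells//; last exact: finite_lattice_points.
  apply: le_measure; [apply/mem_set|apply/mem_set|exact: ball_sub_cells].
    exact: measurable_gauge_ball.
  by apply: mcells; exact: finite_lattice_points.
have low : ((lattice_count (T - 2 * K) * T^-1 ^+ 2)%:E <= mu B)%E.
  rewrite -measure_cells//; last exact: finite_lattice_points.
  apply: le_measure; [apply/mem_set|apply/mem_set|exact: cells_sub_ball].
    by apply: mcells; exact: finite_lattice_points.
  exact: measurable_gauge_ball.
(* Finiteness is needed because [fine] sends an infinite measure to 0. *)
have fB : mu B \is a fin_num.
  rewrite ge0_fin_numE//; apply: (le_lt_trans up); exact: ltry.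
have AE : mu B = A%:E by rewrite /area fineK.
move: up low; rewrite AE !lee_fin exprVn => up low.
have T2 : 0 < T ^+ 2 by rewrite exprn_gt0.
by split; [rewrite -ler_pdivrMr|rewrite -ler_pdivlMr].
Qed.

Lemma lattice_count_asymp : exists2 C : R, 0 < C & forall T : R, 0 <= T ->
  `|lattice_count T - A * T ^+ 2| <= C * (T + 1).
Proof.
have K0 := gauge_lip_gt0 gE; have A0 := gauge_area_ge0.
exists ((A + 1) * (4 * K + 4 * K ^+ 2)) => [|T T0].
  by have ? : 0 < K ^+ 2; [rewrite exprn_gt0|apply: mulr_gt0; lra].
have TK : 0 < T + 2 * K by lra.
have [up _] := gauge_areaE TK; rewrite addrK in up.
have K2 : 0 < K ^+ 2 by rewrite exprn_gt0.
have low : A * T ^+ 2 - 4 * K * A * T <= lattice_count T.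
  have cnt0 : 0 <= lattice_count T by exact: ler0n.
  have [KT|TK'] := ltP (2 * K) T.
    have T2K : 0 < T - 2 * K by lra.
    have [_] := gauge_areaE T2K; rewrite subrK; apply: le_trans.
    have -> : A * (T - 2 * K) ^+ 2 = A * T ^+ 2 - 4 * K * A * T + 4 * (A * K ^+ 2) by ring.
    by rewrite lerDl !mulr_ge0// ltW.
  (* For T <= 2 K there is no inner scale to compare with, but then A T^2 <= 2 K A T makes the
     claimed lower bound nonpositive. *)
  apply: le_trans cnt0; have : A * T * T <= A * T * (2 * K) by rewrite ler_wpM2l// mulr_ge0.
  have : 0 <= A * T * K by rewrite !mulr_ge0// ltW.
  lra.
have AT : 0 <= A * T by exact: mulr_ge0.
have p1 : 0 <= A * K by rewrite mulr_ge0// ltW.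
have p2 : 0 <= A * T * K by rewrite mulr_ge0// ltW.
have p3 : 0 <= A * K ^+ 2 by rewrite mulr_ge0// ltW.
have p4 : 0 <= A * T * K ^+ 2 by rewrite mulr_ge0// ltW.
have p5 : 0 <= T * K by rewrite mulr_ge0// ltW.
have p6 : 0 <= T * K ^+ 2 by rewrite mulr_ge0// ltW.
have -> : (A + 1) * (4 * K + 4 * K ^+ 2) * (T + 1) = 4 * (A * T * K) + 4 * (A * K)
  + 4 * (A * T * K ^+ 2) + 4 * (A * K ^+ 2) + 4 * (T * K) + 4 * K + 4 * (T * K ^+ 2) + 4 * K ^+ 2.
  by ring.
have e : A * (T + 2 * K) ^+ 2 = A * T ^+ 2 + 4 * (A * T * K) + 4 * (A * K ^+ 2) by ring.
rewrite e in up.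
by apply/ler_normlP; split; lra.
Qed.

End GaugeArea.

(** * Primitive vectors *)

Section Basel.
Variable R : realType.
Implicit Types x : R.

Lemma sin_le x : 0 < x -> sin x <= x.
Proof.
move=> x0.
have [|c _] := @MVT R sin cos 0 x x0.
  by apply: continuous_subspaceT; exact: continuous_sin.
by rewrite sin0 !subr0 => ->; rewrite -[X in _ <= X]mul1r ler_wpM2r ?(ltW x0)// cos_le1.
Qed.

Lemma tan_ge x : 0 < x < pi / 2 -> x <= tan x.
Proof.
move=> /andP[x0 xp].
have cosn0 y : 0 <= y <= x -> 0 < cos y.
  by move=> /andP[y0 yx]; apply: cos_gt0_pihalf; have := pi_gt0 R; lra.
have [||c] := @MVT R tan (fun y => (cos y) ^- 2) 0 x x0.
- move=> y; rewrite in_itv /= => /andP[y0 yx].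
  by apply: is_derive_tan; rewrite gt_eqF// cosn0// ltW//= ltW.
- apply: continuous_in_subspaceT => y /set_mem; rewrite /= in_itv /= => yx.
  by apply: continuous_tan; rewrite gt_eqF// cosn0.
rewrite in_itv /= => /andP[c0 cx]; rewrite tan0 !subr0 => ->.
rewrite -[X in X <= _]mul1r ler_wpM2r ?(ltW x0)//.
have cc : 0 < cos c by rewrite cosn0// !ltW.
by rewrite invf_ge1 ?exprn_gt0// expr_le1 ?cos_le1// (ltW cc).
Qed.

(** This is sin x <= x <= tan x together with 1/sin^2 = 1/tan^2 + 1. *)
Lemma inv_sin2_bounds x : 0 < x < pi / 2 ->
  x ^- 2 <= (sin x) ^- 2 <= x ^- 2 + 1.
Proof.
move=> h; have /andP[x0 xp] := h.
have s0 : 0 < sin x by apply: sin_gt0_pihalf.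
have c0 : 0 < cos x by apply: cos_gt0_pihalf; have := pi_gt0 R; lra.
apply/andP; split.
  by rewrite lef_pV2 ?posrE ?exprn_gt0// ler_sqr ?nnegrE ?(ltW x0) ?(ltW s0)// sin_le.
have -> : (sin x) ^- 2 = (tan x) ^- 2 + 1.
  rewrite /tan; have := cos2Dsin2 x; move: (cos x) (sin x) c0 s0 => c s c0 s0 e.
  by rewrite -[X in _ + X](mulfV (_ : s ^+ 2 != 0)) ?expf_neq0 ?gt_eqF// -[in LHS](mul1r (s ^- 2)) -e; field; rewrite !gt_eqF.
have t0 : 0 < tan x by rewrite (lt_le_trans x0)// tan_ge.
by rewrite lerD2r lef_pV2 ?posrE ?exprn_gt0// ler_sqr ?nnegrE ?(ltW x0) ?(ltW t0)// tan_ge.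
Qed.

Lemma inv_sin2_half x : 0 < x < pi ->
  (sin (x / 2)) ^- 2 + (sin (pi / 2 - x / 2)) ^- 2 = 4 * (sin x) ^- 2.
Proof.
move=> /andP[x0 xp].
have s0 : 0 < sin (x / 2) by apply: sin_gt0_pihalf; lra.
have c0 : 0 < cos (x / 2) by apply: cos_gt0_pihalf; lra.
have -> : sin (pi / 2 - x / 2) = cos (x / 2).
  by rewrite sinB sin_pihalf cos_pihalf mul1r mul0r subr0.
have -> : sin x = 2 * (cos (x / 2) * sin (x / 2)).
  by rewrite mulr_natl -sin_mulr2n mulr2n; congr sin; lra.
have := cos2Dsin2 (x / 2); move: (cos _) (sin _) c0 s0 => c s c0 s0 e.
rewrite -[RHS]mulr1 -[X in _ = _ * X]e; field.
by rewrite !gt_eqF.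
Qed.

Let angle (n k : nat) : R := k.*2.+1%:R * pi / 2 ^+ n.+2.

Lemma angle_gt0 n k : 0 < angle n k.
Proof. by rewrite /angle divr_gt0 ?exprn_gt0// mulr_gt0 ?pi_gt0. Qed.

Lemma angle_lt n k : (k < 2 ^ n)%N -> angle n k < pi / 2.
Proof.
move=> kn; rewrite /angle ltr_pdivrMr ?exprn_gt0//.
have -> : pi / 2 * 2 ^+ n.+2 = (2 ^ n.+1)%:R * pi :> R.
  by rewrite natrX exprS; field.
rewrite ltr_pM2r ?pi_gt0// ltr_nat expnS; lia.
Qed.

(** At level n + 1 the first half of the angles are the halves of those at level n, and the second
    half, in reverse order, are their complements to pi/2. [inv_sin2_half] pairs them, so each level
    multiplies the sum by 4, starting from 1/sin^2(pi/4) = 2. *)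
Lemma sum_inv_sin2 n : \sum_(0 <= k < 2 ^ n) (sin (angle n k)) ^- 2 = 2 * 4 ^+ n :> R.
Proof.
elim: n => [|n IH].
  rewrite expn0 big_nat1 expr0 mulr1 /angle mul1r.
  have -> : pi / 2 ^+ 2 = pi / 4 :> R by congr (_ / _); ring.
  have s2 : (sin (pi / 4)) ^+ 2 = 2^-1 :> R.
    have := cos_mulr2n (pi / 4 : R).
    have -> : (pi / 4) *+ 2 = pi / 2 :> R by rewrite mulr2n; lra.
    by rewrite cos_pihalf cos2sin2 mulr2n; lra.
  by rewrite s2 invrK.
rewrite expnS mul2n -addnn (big_cat_nat _ (n := 2 ^ n))//=; last by rewrite leq_addr.
rewrite [X in _ + X](_ : _ = \sum_(0 <= k < 2 ^ n) (sin (pi / 2 - angle n k / 2)) ^- 2); last first.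
  rewrite -[X in \sum_(X <= _ < _) _]add0n big_addn addnK big_nat_rev/= add0n.
  rewrite !big_nat; apply: eq_bigr => k /= kn; congr ((sin _) ^- 2).
  have -> : (2 ^ n - k.+1 + 2 ^ n = 2 ^ n.+1 - k.+1)%N by rewrite expnS; lia.
  rewrite /angle.
  have -> : ((2 ^ n.+1 - k.+1).*2.+1)%:R = 2 * 2 ^+ n.+1 - k.*2.+1%:R :> R.
    rewrite -natrX -natrM -natrB; first by congr (_%:R); rewrite expnS; lia.
    by rewrite expnS; lia.
  rewrite !exprS; field.
  by rewrite expf_neq0.
rewrite -big_split /= [RHS](_ : _ = \sum_(0 <= k < 2 ^ n) 4 * (sin (angle n k)) ^- 2); last first.
  by rewrite -mulr_sumr IH exprS; ring.
rewrite !big_nat; apply: eq_bigr => k /= kn.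
rewrite -inv_sin2_half; last first.
  by rewrite angle_gt0/=; have := angle_lt kn; have := pi_gt0 R; lra.
congr ((sin _) ^- 2 + _).
by rewrite /angle [in LHS]exprS; field; rewrite expf_neq0.
Qed.

Definition odd_inv_squares (n : nat) : R := \sum_(0 <= k < n) k.*2.+1%:R ^- 2.

Definition inv_squares (n : nat) : R := \sum_(0 <= k < n) k.+1%:R ^- 2.

Lemma odd_inv_squares_bounds n :
  pi ^+ 2 / 8 - pi ^+ 2 / 16 / 2 ^+ n <= odd_inv_squares (2 ^ n) <= pi ^+ 2 / 8.
Proof.
have p2 : 0 < pi ^+ 2 :> R by rewrite exprn_gt0// pi_gt0.
have e4 : 4 ^+ n = 2 ^+ n * 2 ^+ n :> R by rewrite -exprMn; congr (_ ^+ _); ring.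
have e : \sum_(0 <= k < 2 ^ n) (angle n k) ^- 2 = odd_inv_squares (2 ^ n) * (16 * 4 ^+ n / pi ^+ 2).
  rewrite /odd_inv_squares mulr_suml; apply: eq_bigr => k _; rewrite /angle.
  rewrite e4 !exprS; move: (pi : R) (pi_gt0 R) => p p0; field.
  by rewrite gt_eqF//= expf_neq0// andbT gt_eqF// nat1r ltr0n.
have bnd k : (k < 2 ^ n)%N -> (angle n k) ^- 2 <= (sin (angle n k)) ^- 2 <= (angle n k) ^- 2 + 1.
  by move=> kn; apply: inv_sin2_bounds; rewrite angle_gt0 angle_lt.
have up : \sum_(0 <= k < 2 ^ n) (angle n k) ^- 2 <= 2 * 4 ^+ n.
  by rewrite -sum_inv_sin2 !big_nat; apply: ler_sum => k /= /bnd/andP[].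
have low : 2 * 4 ^+ n <= \sum_(0 <= k < 2 ^ n) (angle n k) ^- 2 + 2 ^+ n.
  have -> : 2 ^+ n = \sum_(0 <= k < 2 ^ n) 1 :> R.
    by rewrite big_const_nat subn0 iter_addr addr0 natrX.
  by rewrite -big_split/= -sum_inv_sin2 !big_nat; apply: ler_sum => k /= /bnd/andP[].
move: up low; rewrite e => up low.
have p4 : 0 < 4 ^+ n :> R by rewrite exprn_gt0.
have pn : 0 < 2 ^+ n :> R by rewrite exprn_gt0.
move: (odd_inv_squares _) up low => S; rewrite e4.
move: (2 ^+ n) pn (pi ^+ 2) p2 => u u0 q q0 up low.
have uu : 0 < 16 * (u * u) by rewrite !mulr_gt0.
have {}up : S * (16 * (u * u)) <= 2 * (u * u) * q.
  by move: up; rewrite [S * _]mulrA ler_pdivrMr.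
have {}low : 2 * (u * u) * q - u * q <= S * (16 * (u * u)).
  by move: low; rewrite -lerBlDr [S * _]mulrA ler_pdivlMr// mulrBl.
apply/andP; split.
- have -> : q / 8 - q / 16 / u = (2 * (u * u) * q - u * q) / (16 * (u * u)).
    by field; rewrite gt_eqF.
  by rewrite ler_pdivrMr.
- have -> : q / 8 = (2 * (u * u) * q) / (16 * (u * u)) by field; rewrite gt_eqF.
  by rewrite ler_pdivlMr.
Qed.

Lemma inv_squares_double n : inv_squares n.*2 = odd_inv_squares n + inv_squares n / 4.
Proof.
rewrite /inv_squares /odd_inv_squares; elim: n => [|n IH].
  by rewrite double0 !big_nil mul0r addr0.
rewrite doubleS !big_nat_recr//= IH.
have -> : n.*2.+2%:R = 2 * n.+1%:R :> R by rewrite -natrM; congr (_%:R); lia.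
rewrite -addn1 natrD; field.
by rewrite !nat1r !pnatr_eq0.
Qed.

Lemma inv_squares_tail m n : (0 < m)%N -> (m <= n)%N ->
  inv_squares m <= inv_squares n <= inv_squares m + m%:R^-1 - n%:R^-1.
Proof.
move=> m0; rewrite /inv_squares.
elim: n => [|n IH]; first by rewrite leqn0 => /eqP m_0; rewrite m_0 in m0.
rewrite leq_eqVlt => /orP[/eqP ->|]; first by rewrite addrK lexx.
rewrite ltnS => mn; have /andP[h1 h2] := IH mn.
rewrite big_nat_recr//=.
have n0 : 0 < n%:R :> R by rewrite ltr0n (leq_trans m0).
have p : 0 < n.+1%:R ^- 2 :> R by rewrite invr_gt0 exprn_gt0.
have : n.+1%:R ^- 2 <= n%:R^-1 - n.+1%:R^-1 :> R.
  have -> : n%:R^-1 - n.+1%:R^-1 = (n%:R * n.+1%:R)^-1 :> R.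
    by rewrite -natr1; field; rewrite gt_eqF//= gt_eqF// ltr_wpDr.
  rewrite lef_pV2 ?posrE ?mulr_gt0 ?exprn_gt0// expr2 ler_pM2r// -natr1; lra.
move: p => + h3; move: h3 h1 h2.
move: (_ ^- 2) (n.+1%:R^-1) (m%:R^-1) (n%:R^-1) => x y z w h3 h1 h2 x0.
by apply/andP; split; lra.
Qed.

(** pi^2/6 is the fixed point of S -> pi^2/8 + S/4, the limit form of [inv_squares_double]. A
    doubling divides the error by 4 and adds at most (pi^2/16)/2^j from the odd terms, so an error
    of order 2^-j persists. *)
Lemma inv_squares_pow2 : exists2 C : R, 0 < C &
  forall j, `|inv_squares (2 ^ j) - pi ^+ 2 / 6| <= C / 2 ^+ j.
Proof.
have p2 : 0 < pi ^+ 2 :> R by rewrite exprn_gt0// pi_gt0.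
exists (1 + pi ^+ 2) => [|]; first by lra.
elim=> [|j IH].
  rewrite /inv_squares expn0 big_nat1 expr1n invr1 ?expr0 ?divr1 ?invr1 ?mulr1.
  by apply/ler_normlP; split; lra.
rewrite expnS mul2n inv_squares_double.
have /andP[h1 h2] := odd_inv_squares_bounds j.
have u0 : 0 < (2 ^+ j)^-1 :> R by rewrite invr_gt0 exprn_gt0.
move: IH h1 h2; rewrite [2 ^+ j.+1]exprS invfM.
move: (inv_squares _) (odd_inv_squares _) (2 ^+ j)^-1 u0 (pi ^+ 2) p2.
move=> S O u u0 q q0 /ler_normlP[h3 h4] h1 h2.
have qu : 0 < q * u by rewrite mulr_gt0.
by apply/ler_normlP; split; lra.
Qed.

Lemma basel_bounds n : (0 < n)%N ->
  pi ^+ 2 / 6 - n%:R^-1 <= inv_squares n <= pi ^+ 2 / 6.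
Proof.
move=> n0; have [C C0 HC] := inv_squares_pow2.
have key j : (n <= 2 ^ j)%N -> pi ^+ 2 / 6 - n%:R^-1 - C / 2 ^+ j <= inv_squares n
    <= pi ^+ 2 / 6 + C / 2 ^+ j.
  move=> nj; have /andP[h1 h2] := inv_squares_tail n0 nj.
  have /ler_normlP[h3 h4] := HC j.
  have : 0 < (2 ^ j)%:R^-1 :> R by rewrite invr_gt0 ltr0n expn_gt0.
  by move=> ?; apply/andP; split; lra.
have eps (e : R) : 0 < e -> exists2 j, (n <= 2 ^ j)%N & C / 2 ^+ j < e.
  move=> e0; pose b := Num.bound (C / e).
  have hb : C / e < b%:R by apply: archi_boundP; rewrite divr_ge0 ?ltW.
  exists (maxn n b).
    by rewrite (leq_trans (leq_maxl n b))// ltnW// ltn_expl.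
  rewrite ltr_pdivrMr ?exprn_gt0// mulrC -ltr_pdivrMr//.
  rewrite (lt_le_trans hb)// -natrX ler_nat.
  by rewrite (leq_trans (leq_maxr n b))// ltnW// ltn_expl.
apply/andP; split; rewrite leNgt; apply/negP => h.
- have [|j nj hj] := eps (pi ^+ 2 / 6 - n%:R^-1 - inv_squares n).
    by rewrite subr_gt0.
  by have /andP[] := key j nj; lra.
- have [|j nj hj] := eps (inv_squares n - pi ^+ 2 / 6).
    by rewrite subr_gt0.
  by have /andP[] := key j nj; lra.
Qed.

End Basel.

(** * The Moebius function and its sum over inverse squares *)

Section Mobius.
Variable R : realType.

Definition mobius (n : nat) : R :=
  if all (fun p => logn p n == 1%N) (primes n) then (-1) ^+ size (primes n) else 0.

Lemma norm_mobius_le1 n : `|mobius n| <= 1.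
Proof. by rewrite /mobius; case: ifP; rewrite ?normr0// normrX normrN1 expr1n. Qed.

Lemma mobiusM_prime (p d : nat) : prime p -> (0 < d)%N ->
  mobius (p * d) = if (p %| d)%N then 0 else - mobius d.
Proof.
move=> pp d0; have p0 := prime_gt0 pp.
have mem q : (q \in primes (p * d)) = (q == p) || (q \in primes d).
  by rewrite primesM// primes_prime// inE.
have lg q : logn q (p * d) = ((p == q) * (logn q p) + logn q d)%N.
  by rewrite lognM// logn_prime//; case: eqVneq => [->|]; rewrite ?eqxx ?mul1n// mul0n.
case: ifPn => pd.
  rewrite /mobius ifF//; apply/negP => /allP/(_ p); rewrite mem eqxx => /(_ isT).
  rewrite lg eqxx mul1n logn_prime// eqxx add1n eqSS => /eqP l0.
  by move: (logn_gt0 p d); rewrite l0 mem_primes pp d0 pd.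
have pnd : p \notin primes d by rewrite mem_primes pp d0 (negbTE pd).
have perm : perm_eq (primes (p * d)) (p :: primes d).
  apply: uniq_perm; rewrite ?primes_uniq//= ?pnd ?primes_uniq//.
rewrite /mobius (perm_size perm) (perm_all _ perm) /= lg eqxx mul1n.
rewrite logn_prime// eqxx (_ : logn p d = 0%N); last by rewrite lognE pp d0 (negbTE pd).
rewrite addn0 eqxx /=.
have -> : all (fun q => logn q (p * d) == 1%N) (primes d) = all (fun q => logn q d == 1%N) (primes d).
  apply: eq_in_all => q qd; rewrite lg; case: (eqVneq p q) => [pq|_]; last by [].
  by rewrite -pq (negbTE pnd) in qd.
by case: ifP => _; rewrite ?oppr0// exprS mulN1r.
Qed.

(** Let p be a prime factor of n = p m. A divisor p d of n contributes - mu(d) if p does not divide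
    d, and 0 otherwise. These terms cancel against the divisors of n prime to p, which are the
    divisors of m prime to p. *)
Lemma sum_mobius_divisors n : (0 < n)%N ->
  \sum_(d <- divisors n) mobius d = (n == 1%N)%:R.
Proof.
move=> n0; case: (ltngtP n 1) => [|n1|->]; first by case: n n0.
  pose p := pdiv n; have pp : prime p by exact: pdiv_prime.
  have pn : (p %| n)%N by exact: pdiv_dvd.
  pose m := (n %/ p)%N; have nE : n = (p * m)%N by rewrite mulnC divnK.
  have m0 : (0 < m)%N by move: n0; rewrite nE muln_gt0 => /andP[].
  have p0 := prime_gt0 pp.
  rewrite (bigID (fun d => p %| d)%N)/= -big_filter.
  have perm : perm_eq [seq d <- divisors n | (p %| d)%N] [seq (p * d)%N | d <- divisors m].
    apply: uniq_perm; rewrite ?filter_uniq ?divisors_uniq//.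
      rewrite map_inj_uniq ?divisors_uniq// => x y /eqP.
      by rewrite eqn_pmul2l// => /eqP.
    move=> d; rewrite mem_filter -dvdn_divisors//; apply/andP/mapP => [[/dvdnP[e ->]]|[e]].
      rewrite mulnC nE dvdn_pmul2l// => em; exists e => //.
      by rewrite -dvdn_divisors.
    by rewrite -dvdn_divisors// => em ->; rewrite dvdn_mulr// nE dvdn_pmul2l.
  rewrite (perm_big _ perm) big_map /=.
  rewrite (bigID (fun d => p %| d)%N)/= big1_seq ?add0r; last first.
    move=> d /andP[pd]; rewrite -dvdn_divisors// => dm.
    by rewrite mobiusM_prime ?pd// (dvdn_gt0 m0).
  rewrite -[X in _ + X]big_filter -[X in X + _]big_filter.
  have perm2 : perm_eq [seq d <- divisors n | ~~ (p %| d)%N] [seq d <- divisors m | ~~ (p %| d)%N].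
    apply: uniq_perm; rewrite ?filter_uniq ?divisors_uniq// => d.
    rewrite !mem_filter -!dvdn_divisors//; case: (boolP (p %| d)%N) => //= pd.
    rewrite nE Gauss_dvdr// coprime_sym prime_coprime//.
  rewrite (perm_big _ perm2) !big_filter -big_split /= big1_seq//.
  move=> d /andP[pd]; rewrite -dvdn_divisors// => dm.
  by rewrite mobiusM_prime ?(negbTE pd) ?addNr// (dvdn_gt0 m0).
by rewrite big_seq1.
Qed.

Lemma sum_mobius_dvd (Y n : nat) : (0 < n)%N -> (n <= Y)%N ->
  \sum_(1 <= d < Y.+1 | (d %| n)%N) mobius d = (n == 1%N)%:R.
Proof.
move=> n0 nY; rewrite -sum_mobius_divisors// -big_filter; apply: perm_big.
apply: uniq_perm; rewrite ?filter_uniq ?iota_uniq ?divisors_uniq// => d.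
rewrite mem_filter mem_index_iota -dvdn_divisors// ltnS.
case: (boolP (d %| n)%N) => //= dn.
by rewrite (dvdn_gt0 n0 dn) (leq_trans (dvdn_leq n0 dn)).
Qed.

Lemma sum_multiples (F : nat -> R) (Y d : nat) : (0 < d)%N ->
  \sum_(1 <= n < Y.+1 | (d %| n)%N) F n = \sum_(1 <= e < (Y %/ d).+1) F (d * e)%N.
Proof.
move=> d0; rewrite -big_filter -(big_map (fun e => d * e)%N xpredT F); apply: perm_big.
apply: uniq_perm; rewrite ?filter_uniq ?iota_uniq//.
  rewrite map_inj_uniq ?iota_uniq// => x y /eqP.
  by rewrite eqn_pmul2l// => /eqP.
move=> n; rewrite mem_filter mem_index_iota ltnS.
apply/andP/mapP => [[/dvdnP[e ->] /andP[h1 h2]]|[e]].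
  exists e; last by rewrite mulnC.
  rewrite mem_index_iota ltnS leq_divRL// h2 andbT.
  by move: h1; rewrite muln_gt0 => /andP[].
rewrite mem_index_iota ltnS => /andP[h1 h2] ->.
by rewrite dvdn_mulr// muln_gt0 d0 h1 mulnC -leq_divRL.
Qed.

Definition harmonic_sum (n : nat) : R := \sum_(1 <= d < n.+1) d%:R^-1.

Lemma harmonic_sum_le n : (0 < n)%N -> harmonic_sum n <= 1 + ln n%:R.
Proof.
rewrite /harmonic_sum; elim: n => // -[_ _|n IH _].
  by rewrite big_nat1 invr1 ln1 addr0.
rewrite big_nat_recr//=; have := IH isT.
set H := \sum_(_ <= _ < _) _; have n0 : 0 < n.+1%:R :> R by rewrite ltr0n.
have m0 : 0 < n.+2%:R :> R by rewrite ltr0n.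
have : n.+2%:R^-1 <= ln n.+2%:R - ln n.+1%:R :> R.
  rewrite -ln_div ?posrE// -[n.+2%:R / _]invrK lnV ?posrE ?invr_gt0 ?divr_gt0//.
  rewrite lerNr invf_div (_ : n.+1%:R / n.+2%:R = 1 + (- n.+2%:R^-1)).
    by apply: le_ln1Dx; rewrite ltrN2 invf_lt1// ltr1n.
  by rewrite -[n.+2%:R]natr1; field; rewrite gt_eqF// ltr_wpDr.
by move: (n.+2%:R^-1) (ln n.+2%:R) (ln n.+1%:R) => x y z h1 h2; lra.
Qed.

Lemma harmonic_sum_ge0 n : 0 <= harmonic_sum n.
Proof. by apply: sumr_ge0 => d _; rewrite invr_ge0. Qed.

(** Grouping the pairs (d, e) by n = d e gives the sum of mu(d)/d^2 times [inv_squares] of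
    floor(Y/d) as exactly 1. Replacing each inner sum by pi^2/6 costs at most 1/floor(Y/d) <= 2 d/Y,
    in total 2 H(Y)/Y with H(Y) the harmonic sum, and multiplication by 6/pi^2 makes the constant
    12/pi^2. *)
Lemma sum_mobius_inv_squares (Y : nat) : (0 < Y)%N ->
  `|\sum_(1 <= d < Y.+1) mobius d / d%:R ^+ 2 - 6 / pi ^+ 2|
    <= 12 / pi ^+ 2 * (harmonic_sum Y / Y%:R).
Proof.
move=> Y0; have p2 : 0 < pi ^+ 2 :> R by rewrite exprn_gt0// pi_gt0.
have YR : 0 < Y%:R :> R by rewrite ltr0n.
have e1 : \sum_(1 <= d < Y.+1) mobius d / d%:R ^+ 2 * inv_squares R (Y %/ d) = 1.
  transitivity (\sum_(1 <= d < Y.+1) \sum_(1 <= n < Y.+1 | (d %| n)%N) mobius d / n%:R ^+ 2).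
    rewrite !big_nat; apply: eq_bigr => d /andP[d0 dY].
    rewrite (sum_multiples (fun n => mobius d / n%:R ^+ 2))// /inv_squares.
    rewrite big_add1 /= mulr_sumr.
    apply: eq_bigr => e _; rewrite natrM exprMn [(_ * _)^-1 in RHS]invfM.
    by rewrite mulrA.
  rewrite (exchange_big_dep_nat xpredT)//=.
  rewrite big_ltn// [X in _ + X]big_nat [X in _ + X]big1 ?addr0 => [|n /andP[n1 nY]].
    by rewrite -mulr_suml sum_mobius_dvd//= expr1n invr1 mulr1.
  by rewrite -mulr_suml sum_mobius_dvd ?(gtn_eqF n1) ?mul0r// ltnW.
have e2 : \sum_(1 <= d < Y.+1) mobius d / d%:R ^+ 2 * (inv_squares R (Y %/ d) - pi ^+ 2 / 6)
    = 1 - (\sum_(1 <= d < Y.+1) mobius d / d%:R ^+ 2) * (pi ^+ 2 / 6).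
  by rewrite -[X in _ = X - _]e1 mulr_suml -sumrB; apply: eq_bigr => d _; rewrite mulrBr.
have h : `|1 - (\sum_(1 <= d < Y.+1) mobius d / d%:R ^+ 2) * (pi ^+ 2 / 6)|
    <= 2 * (harmonic_sum Y / Y%:R).
  rewrite -e2 (le_trans (ler_norm_sum _ _ _))//.
  rewrite /harmonic_sum mulr_suml mulr_sumr !big_nat; apply: ler_sum => d /andP[d0 dY].
  have dR : 0 < d%:R :> R by rewrite ltr0n.
  rewrite !normrM normfV normrX (gtr0_norm dR).
  have m0 : (0 < Y %/ d)%N by rewrite divn_gt0// -ltnS.
  have mR : 0 < (Y %/ d)%:R :> R by rewrite ltr0n.
  have hm : `|inv_squares R (Y %/ d) - pi ^+ 2 / 6| <= (Y %/ d)%:R^-1.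
    have /andP[h1 h2] := basel_bounds R m0.
    by apply/ler_normlP; split; lra.
  have hm2 : (Y %/ d)%:R^-1 <= 2 * d%:R / Y%:R :> R.
    rewrite -[leRHS]invrK lef_pV2 ?posrE// ?invr_gt0 ?divr_gt0 ?mulr_gt0//.
    rewrite invf_div ler_pdivrMr ?mulr_gt0// -!natrM ler_nat.
    by have := ltn_ceil Y d0; nia.
  rewrite (@le_trans _ _ (1 / d%:R ^+ 2 * (2 * d%:R / Y%:R)))//.
    have d20 : 0 <= (d%:R ^+ 2)^-1 :> R by rewrite invr_ge0 exprn_ge0// ltW.
    apply: ler_pM; [exact: mulr_ge0|exact: normr_ge0| |exact: le_trans hm hm2].
    by rewrite ler_wpM2r// norm_mobius_le1.
  by rewrite le_eqVlt; apply/orP; left; apply/eqP; field; rewrite !gt_eqF.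
move: h; move: (\sum_(_ <= _ < _) _) (harmonic_sum Y / _) (pi ^+ 2) p2 => S H q q0 h.
have -> : S - 6 / q = - (6 / q) * (1 - S * (q / 6)) by field; rewrite gt_eqF.
rewrite normrM normrN (@gtr0_norm _ (6 / q)) ?divr_gt0//.
have -> : 12 / q * H = 6 / q * (2 * H) by field; rewrite gt_eqF.
by rewrite ler_pM2l// divr_gt0.
Qed.

End Mobius.

(** * Counting primitive vectors under a gauge *)

Section PrimitiveCount.
Variables (R : realType) (K c : R) (E : R -> R -> R).
Hypothesis gE : gauge K c E.

Definition points (T : R) : seq (int * int) := enum_fset (fset_set (lattice_points E T)).

Lemma mem_points T u : (u \in points T) = (E u.1%:~R u.2%:~R <= T).
Proof.
rewrite /points; have -> : (u \in enum_fset (fset_set (lattice_points E T)))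
    = (u \in fset_set (lattice_points E T)) by [].
rewrite in_fset_set; last exact: (finite_lattice_points gE).
by apply/idP/idP => [/set_mem|h]; [|apply/mem_set].
Qed.

Lemma points_uniq T : uniq (points T).
Proof. exact: fset_uniq. Qed.

Lemma size_points T : (size (points T))%:R = lattice_count E T.
Proof. by []. Qed.

Let nz (u : int * int) := u != (0, 0).

Lemma count_nonzero T : 0 <= T -> (count nz (points T))%:R = lattice_count E T - 1.
Proof.
move=> T0; rewrite -size_points -(count_predC nz (points T)) natrD.
have -> : count (predC nz) (points T) = count_mem (0, 0) (points T).
  by apply: eq_count => u /=; rewrite /nz negbK.
by rewrite count_uniq_mem ?points_uniq// mem_points/= (gauge00 gE) T0 addrK.
Qed.

Definition primitive_count (T : R) : nat := count (fun u => coprimez u.1 u.2) (points T).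

Let dvd (d : nat) (u : int * int) := (d %| gcdn (absz u.1) (absz u.2))%N.

Lemma count_multiples T d : (0 < d)%N ->
  count (fun u => nz u && dvd d u) (points T) = count nz (points (T / d%:R)).
Proof.
move=> d0; have dR : 0 < d%:R :> R by rewrite ltr0n.
pose f (u : int * int) := (d%:Z * u.1, d%:Z * u.2).
rewrite -!size_filter -[RHS](size_map f); apply: perm_size; apply: uniq_perm.
- by rewrite filter_uniq ?points_uniq.
- rewrite map_inj_uniq ?filter_uniq ?points_uniq// => -[a b] [a' b'] [].
  by move=> /mulfI h1 /mulfI h2; rewrite h1 ?h2//; lia.
move=> u; rewrite mem_filter mem_points; apply/andP/mapP.
- move=> [/andP[u0]]; rewrite /dvd dvdn_gcd => /andP[h1 h2].
  case: u u0 h1 h2 => a b u0 /= h1 h2 h.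
  have /dvdzP[a' ea] : (d%:Z %| a)%Z by [].
  have /dvdzP[b' eb] : (d%:Z %| b)%Z by [].
  exists (a', b'); last by rewrite ea eb /f /= mulrC [_ * b']mulrC.
  rewrite mem_filter mem_points /=; apply/andP; split.
    by apply: contraNneq u0 => -[a0 b0]; rewrite ea eb a0 b0 !mul0r.
  rewrite ler_pdivlMr// mulrC -(gauge_scale gE)//.
  by move: h; rewrite ea eb !intrM -pmulrn ![_ * d%:R]mulrC.
- move=> [[a b]]; rewrite mem_filter mem_points /= => /andP[u0 h] ->.
  rewrite /f /=; split.
    apply/andP; split.
      apply: contraNneq u0 => -[/eqP a0 /eqP b0].
      by move: a0 b0; rewrite !mulf_eq0 => /orP[/eqP|/eqP ->] ; [lia|] => /orP[/eqP|/eqP ->]; [lia|].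
    by rewrite /dvd dvdn_gcd !abszM !dvdn_mulr.
  by rewrite !intrM -pmulrn (gauge_scale gE)// mulrC -ler_pdivlMr.
Qed.

(** The gcd of a nonzero point is at most |a| + |b| <= T/c <= Y, so the sum up to Y meets all its
    divisors. The origin, divisible by every d, is kept out of the counts. *)
Lemma primitive_count_mobius T (Y : nat) : T / c <= Y%:R ->
  (primitive_count T)%:R =
    \sum_(1 <= d < Y.+1) mobius R d * (count nz (points (T / d%:R)))%:R.
Proof.
move=> TY; have c0 := gauge_low_gt0 gE.
have e1 : (primitive_count T)%:R = \sum_(u <- points T | nz u)
    \sum_(1 <= d < Y.+1 | dvd d u) mobius R d.
  rewrite /primitive_count -sum1_count natr_sum big_mkcond [RHS]big_mkcond.
  rewrite !big_seq; apply: eq_bigr => -[a b]; rewrite mem_points /nz /= => h.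
  case: eqVneq => [[-> ->]|u0] /=; first by [].
  have g0 : (0 < gcdn (absz a) (absz b))%N.
    rewrite gcdn_gt0 !absz_gt0 -negb_and; apply: contra u0 => /andP[/eqP -> /eqP ->].
    by [].
  rewrite /dvd /= sum_mobius_dvd//.
    by rewrite /coprimez /gcdz eqz_nat; case: (_ == _).
  have gab : (gcdn (absz a) (absz b) <= absz a + absz b)%N.
    have [/eqP a0|a0] := boolP (absz a == 0%N); first by rewrite a0 gcd0n.
    by rewrite (leq_trans (dvdn_leq _ (dvdn_gcdl _ _))) ?lt0n// leq_addr.
  rewrite (leq_trans gab)// -(ler_nat R) (le_trans _ TY)// ler_pdivlMr// mulrC.
  apply: le_trans h; apply: le_trans (gauge_low gE _ _).
  by rewrite ler_pM2l// natrD !natr_absz !intr_norm.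
rewrite e1 (exchange_big_dep xpredT)//= !big_nat; apply: eq_bigr => d /andP[d0 _].
by rewrite big_const_seq iter_addr addr0 -[LHS]mulr_natr count_multiples.
Qed.

Local Notation A := (area [set p : R * R | E p.1 p.2 <= 1]).

(** For each d the lattice count errs by C (T/d + 1), and leaving out the origin by 1. As d <= Y <=
    2 T/c gives 1 <= (2/c) T/d, both are multiples of T/d and sum to a multiple of T H(Y), with H(Y)
    the harmonic sum. Cutting the Moebius series at Y costs a multiple of T^2 H(Y)/Y, where T/Y <=
    c. *)
Lemma primitive_count_harmonic : exists2 C : R, 0 < C & forall (T : R) (Y : nat),
  c <= T -> T / c <= Y%:R -> Y%:R <= 2 * T / c ->
  `|(primitive_count T)%:R - A * (6 / pi ^+ 2) * T ^+ 2| <= C * (T * harmonic_sum R Y).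
Proof.
have c0 := gauge_low_gt0 gE.
have [C C0 HC] := lattice_count_asymp gE.
have A0 := gauge_area_ge0 E.
have p2 : 0 < pi ^+ 2 :> R by rewrite exprn_gt0// pi_gt0.
have q12 : 0 <= 12 / pi ^+ 2 :> R by rewrite divr_ge0// ltW.
pose C1 := C + (C + 1) * (2 / c).
have C10 : 0 < C1 by rewrite addr_gt0// mulr_gt0 ?divr_gt0//; lra.
exists (C1 + A * (12 / pi ^+ 2) * c) => [|T Y cT TY YT].
  by rewrite ltr_wpDr// mulr_ge0 ?(ltW c0)// mulr_ge0.
have T0 : 0 < T by lra.
have YR : 0 < Y%:R :> R by rewrite (lt_le_trans _ TY)// divr_gt0.
have Y0 : (0 < Y)%N by rewrite -(ltr0n R).
rewrite (primitive_count_mobius TY).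
have H0 := harmonic_sum_ge0 R Y.
have main : `|\sum_(1 <= d < Y.+1) mobius R d * ((count nz (points (T / d%:R)))%:R
    - A * (T / d%:R) ^+ 2)| <= C1 * (T * harmonic_sum R Y).
  rewrite (le_trans (ler_norm_sum _ _ _))// /harmonic_sum mulr_sumr mulr_sumr.
  rewrite !big_nat; apply: ler_sum => d /andP[d0 dY].
  have dR : 0 < d%:R :> R by rewrite ltr0n.
  have Td : 0 < T / d%:R by rewrite divr_gt0.
  rewrite normrM -[leRHS]mul1r ler_pM// ?norm_mobius_le1//.
  rewrite count_nonzero; last exact: ltW.
  have := HC _ (ltW Td); have : 1 <= 2 / c * (T / d%:R).
    rewrite mulrA ler_pdivlMr// mul1r mulrAC (le_trans _ YT)// ler_nat -ltnS//.
  move: (T / d%:R) (lattice_count E _) Td => t L t0 h1 /ler_normlP[h2 h3].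
  have : (C + 1) * 1 <= (C + 1) * (2 / c * t) by rewrite ler_pM2l//; lra.
  by rewrite /C1 mulrDl -mulrA => ?; apply/ler_normlP; split; lra.
have e : \sum_(1 <= d < Y.+1) mobius R d * (count nz (points (T / d%:R)))%:R
    - A * (6 / pi ^+ 2) * T ^+ 2
  = \sum_(1 <= d < Y.+1) mobius R d * ((count nz (points (T / d%:R)))%:R - A * (T / d%:R) ^+ 2)
    + A * T ^+ 2 * (\sum_(1 <= d < Y.+1) mobius R d / d%:R ^+ 2 - 6 / pi ^+ 2).
  rewrite mulrBr mulr_sumr addrA -big_split /=; congr (_ - _); last by rewrite mulrAC.
  apply: eq_bigr => d _; rewrite mulrBr -addrA; rewrite [X in _ = _ + X](_ : _ = 0) ?addr0//.
  by rewrite expr_div_n; move: (d%:R ^- 2) => z; ring.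
rewrite e (le_trans (ler_normD _ _))// [leRHS]mulrDl lerD//.
rewrite normrM ger0_norm; last by rewrite mulr_ge0// exprn_ge0// (ltW T0).
apply: (@le_trans _ _ (A * T ^+ 2 * (12 / pi ^+ 2 * (harmonic_sum R Y / Y%:R)))).
  by rewrite ler_wpM2l ?sum_mobius_inv_squares// mulr_ge0// exprn_ge0// (ltW T0).
have : T / Y%:R <= c by rewrite ler_pdivrMr// mulrC -ler_pdivrMr.
move=> h.
have -> : A * T ^+ 2 * (12 / pi ^+ 2 * (harmonic_sum R Y / Y%:R))
    = A * (12 / pi ^+ 2) * (T / Y%:R) * (T * harmonic_sum R Y).
  by move: (12 / _) (Y%:R^-1) => y z; ring.
rewrite ler_wpM2r//; first by rewrite mulr_ge0// (ltW T0).
by rewrite ler_wpM2l// mulr_ge0.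
Qed.

Lemma primitive_count_asymp : exists C T0 : R, 0 < C /\ forall T : R, T0 <= T ->
  `|(primitive_count T)%:R - A * (6 / pi ^+ 2) * T ^+ 2| <= C * (T * ln T).
Proof.
have c0 := gauge_low_gt0 gE.
have [C C0 HC] := primitive_count_harmonic.
pose L := `|ln (2 / c)|.
(* T >= c gives floor(T/c) + 1 <= 2 T/c, and T >= e gives ln T >= 1, so that 1 + ln Y <= 1 + L + ln
   T <= (2 + L) ln T. *)
exists (C * (2 + L)), (c + expR 1); split=> [|T cT].
  by rewrite mulr_gt0// ltr_wpDr// normr_ge0.
have e0 := expR_gt0 (1 : R).
have T0 : 0 < T by lra.
have lnT : 1 <= ln T by rewrite -[1]expRK ler_ln ?posrE ?expR_gt0//; lra.
have Tc1 : 1 <= T / c by rewrite ler_pdivlMr// mul1r; lra.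
pose Y := (absz (Num.floor (T / c))).+1.
have YE : Y%:R = (Num.floor (T / c))%:~R + 1 :> R.
  rewrite /Y -natr1 natr_absz ger0_norm// floor_ge0; lra.
have TY : T / c <= Y%:R.
  by rewrite YE -[1]/(1%:~R) -intrD ltW// floorD1_gt.
have YT : Y%:R <= 2 * T / c.
  have := floor_le_tmp (T / c); rewrite YE -mulrA; lra.
have cT' : c <= T by lra.
apply: le_trans (HC T Y cT' TY YT) _; rewrite -mulrA ler_pM2l//.
rewrite [leRHS]mulrCA ler_pM2l//.
apply: le_trans (harmonic_sum_le R _) _ => //.
have YR : 0 < Y%:R :> R by rewrite ltr0n.
have : ln Y%:R <= ln (2 / c) + ln T.
  have c2 : 0 < 2 / c by rewrite divr_gt0.
  have c2T : 0 < 2 / c * T by exact: mulr_gt0.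
  by rewrite -lnM ?posrE// ler_ln ?posrE// [2 / c * T]mulrAC.
have : ln (2 / c) <= L by exact: ler_norm.
have : L <= L * ln T by rewrite ler_peMr// normr_ge0.
lra.
Qed.

End PrimitiveCount.

(** * Counting regions *)

Section Representatives.

Definition coprime_rep (q : P1Q) : int * int :=
  if q is Some r then (denq r, numq r) else (0, 1).

Let neg (u : int * int) : int * int := (- u.1, - u.2).

Lemma coprime_repK q : Defs.frac (coprime_rep q).2 (coprime_rep q).1 = q.
Proof.
case: q => [r|]//=; rewrite /Defs.frac.
by rewrite (negbTE (denq_neq0 r)) divq_num_den.
Qed.

Lemma coprime_rep_coprime q : coprimez (coprime_rep q).1 (coprime_rep q).2.
Proof.
case: q => [r|]//=; rewrite coprimez_sym; exact: coprime_num_den.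
Qed.

Lemma coprime_rep_gt0 q : 0 < (coprime_rep q).1 \/ coprime_rep q = (0, 1).
Proof. by case: q => [r|]; [left; exact: denq_gt0|right]. Qed.

Lemma coprime_rep_frac (a b : int) : coprimez a b ->
  (a, b) = coprime_rep (Defs.frac b a) \/ (a, b) = neg (coprime_rep (Defs.frac b a)).
Proof.
move=> co; have pos (a' b' : int) : 0 < a' -> coprimez a' b' ->
    (a', b') = coprime_rep (Defs.frac b' a').
  move=> a0 co'; rewrite /Defs.frac gt_eqF//=.
  rewrite coprimeq_num ?coprimeq_den; last 2 first.
    by rewrite coprime_sym.
    by rewrite coprime_sym.
  by rewrite gt_eqF// gtr0_sg// mul1r gtr0_norm.
have [a0|a0|a0] := ltgtP a 0.
- right; have e : Defs.frac b a = Defs.frac (- b) (- a).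
    rewrite /Defs.frac oppr_eq0; case: eqP => // _.
    by rewrite !rmorphN invrN mulrNN.
  rewrite e -pos /neg ?opprK ?oppr_gt0//=.
  by rewrite /coprimez gcdNz gcdzN.
- by left; apply: pos.
- rewrite a0 /Defs.frac eqxx /neg /= oppr0.
  move: co; rewrite a0 /coprimez gcd0z => h.
  have [] : b = 1 \/ b = -1 by lia.
    by move=> ->; left.
  by move=> ->; right.
Qed.

Lemma frac_neg_rep q : Defs.frac (neg (coprime_rep q)).2 (neg (coprime_rep q)).1 = q.
Proof.
rewrite -[RHS]coprime_repK /Defs.frac /= oppr_eq0; case: eqP => // _.
by rewrite !rmorphN invrN mulrNN.
Qed.

Lemma count_primitive (s : seq (int * int)) (Q : set P1Q) : uniq s -> finite_set Q ->
  (forall u, u \in s -> coprimez u.1 u.2 -> Q (Defs.frac u.2 u.1)) ->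
  (forall u, coprimez u.1 u.2 -> Q (Defs.frac u.2 u.1) -> u \in s) ->
  count (fun u => coprimez u.1 u.2) s = (2 * #|` fset_set Q|)%N.
Proof.
move=> us fQ sQ Qs.
have memQ q : (q \in enum_fset (fset_set Q)) = (q \in Q).
  have -> : (q \in enum_fset (fset_set Q)) = (q \in fset_set Q) by [].
  by rewrite in_fset_set.
pose e := enum_fset (fset_set Q).
have ue : uniq e by exact: fset_uniq.
have negK : involutive neg by move=> [a b]; rewrite /neg /= !opprK.
have rep_inj : injective coprime_rep.
  by move=> x y h; rewrite -[x]coprime_repK -[y]coprime_repK h.
have negrep_inj : injective (fun q => neg (coprime_rep q)).
  by move=> x y /(can_inj negK) /rep_inj.
have neg_coprime q : coprimez (neg (coprime_rep q)).1 (neg (coprime_rep q)).2.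
  by rewrite /coprimez /= gcdNz gcdzN; exact: coprime_rep_coprime.
rewrite -size_filter mul2n -addnn.
rewrite -{1}(size_map coprime_rep) -{1}(size_map (fun q => neg (coprime_rep q))) -size_cat.
apply: perm_size; apply: uniq_perm; first by rewrite filter_uniq.
  rewrite cat_uniq !map_inj_uniq// ue /= andbT; apply/hasPn => u /mapP[q _ ->].
  apply/negP => /mapP[q' _]; have := coprime_rep_gt0 q; have := coprime_rep_gt0 q'.
  case: (coprime_rep q) (coprime_rep q') => [a b] [a' b']; rewrite /neg /=.
  move=> h1 h2 [h3 h4]; case: h1 => [h1|[h1 h1']]; case: h2 => [h2|[h2 h2']]; lia.
move=> [a b]; rewrite mem_filter mem_cat; apply/andP/orP => /=.
- move=> [co h]; have Qab := sQ _ h co; rewrite /= in Qab.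
  have := coprime_rep_frac co; move=> [->|->]; [left|right];
    by apply/mapP; exists (Defs.frac b a) => //; rewrite memQ; apply/mem_set.
- case=> /mapP[q]; rewrite memQ => /set_mem hq uE; rewrite uE.
    split; first by have := coprime_rep_coprime q; rewrite -uE.
    by apply: Qs; [exact: coprime_rep_coprime|rewrite coprime_repK].
  split; first by have := neg_coprime q; rewrite -uE.
  by apply: Qs; [exact: neg_coprime|rewrite frac_neg_rep].
Qed.

End Representatives.

Section Final.
Variables (R : realType) (G : markov_topograph R) (F : farey_indexing G) (D : R).
Hypothesis label_range : forall r, label G r < - 2 \/ 2 < label G r.
Hypothesis discr : has_discriminator G D.

Lemma topograph_index_label : topograph D (index_label F).
Proof.
split.
- by move=> a b c d u; have [] := index_label_topograph F discr u.
- by move=> a b c d u; have [] := index_label_topograph F discr u.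
- exact: index_labelN.
- move=> a b; rewrite /index_label /mstar.
  by case: (label_range (Defs.reg F (Defs.frac b a))) => h;
  rewrite real_ltr_normr ?num_real//; apply/orP; (by right; lra) || (by left; lra).
Qed.

Hypothesis D_neq4 : D <> 4.

Lemma label_gauge : exists K c : R, exists E : R -> R -> R, gauge K c E /\
  forall a b : int, coprimez a b -> E a%:~R b%:~R = rho `|mstar F (Defs.frac b a)|.
Proof.
have [K [c [K0 c0 H]]] := int_length_lip D_neq4 topograph_index_label.
have lip a b a' b' := (H a b a' b').1.
have low a b := (H a b 0 0).2.
exists K, (Num.min c K), (mcshane (int_length (index_label F)) K); split.
- split=> //.
  + by rewrite lt_min c0.
  + exact: mcshane_lip K0 c0 low.
  + exact: mcshane_scale K0 c0 low.
  + exact: mcshane_lower K0 c0 low.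
- move=> a b co; rewrite (mcshane_int K0 c0 lip low) ?int_length_coprime//.
  by move=> n a' b' n0; exact: int_lengthZ.
Qed.

Lemma mstar_gt2 q : 2 < `|mstar F q|.
Proof.
by case: (label_range (Defs.reg F q)) => h; rewrite /mstar real_ltr_normr ?num_real//; apply/orP; (by right; lra) || (by left; lra).
Qed.

Lemma label_count_primitive K c E (X : R) : gauge K c E ->
  (forall a b : int, coprimez a b -> E a%:~R b%:~R = rho `|mstar F (Defs.frac b a)|) ->
  2 < X -> primitive_count E (rho X) = (2 * label_count F X)%N.
Proof.
move=> gE EE X2; rewrite /primitive_count /label_count.
have mem u : coprimez u.1 u.2 ->
    (u \in points E (rho X)) = (`|mstar F (Defs.frac u.2 u.1)| <= X).
  by move=> co; rewrite (mem_points gE) EE// ler_rho// mstar_gt2.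
apply: count_primitive.
- exact: points_uniq.
- apply: (@sub_finite_set _ _ ((fun u => Defs.frac u.2 u.1) @` lattice_points E (rho X))).
    move=> q /= hq; exists (coprime_rep q); last exact: coprime_repK.
    rewrite /lattice_points /= EE ?coprime_repK ?ler_rho ?mstar_gt2//.
    exact: coprime_rep_coprime.
  apply: finite_image; exact: (finite_lattice_points gE).
- by move=> u us co /=; rewrite -mem.
- by move=> u co /= h; rewrite mem.
Qed.

End Final.

Theorem theorem11p10 (R : realType) (G : markov_topograph R)
    (F : farey_indexing G) (D : R)
    (label_range : forall r, label G r < - 2 \/ 2 < label G r)
    (discr : has_discriminator G D) (D_neq4 : D <> 4) :
  exists rad : R -> R,
    unique (polar_extension (point_set F)) rad /\
    exists2 C : R, 0 < C &
      \forall X \near +oo,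
        `|(label_count F X)%:R
          - 3 * area (polar_ball rad) / pi ^+ 2 * ln X ^+ 2|
        <= C * (ln X * ln (ln X)).
Proof.
have [K [c [E [gE EE]]]] := label_gauge F label_range discr D_neq4.
have PE p : point_set F p <-> exists a b : int, coprimez a b /\
    p = (a%:~R / E a%:~R b%:~R, b%:~R / E a%:~R b%:~R).
  split=> [[k [n [co ->]]]|[a [b [co ->]]]].
    by exists n, k; rewrite coprimez_sym EE// coprimez_sym.
  by exists b, a; rewrite coprimez_sym EE.
exists (gauge_radius E); split.
  split; first exact: (gauge_polar_extension gE PE).
  exact: (gauge_radius_unique gE PE).
rewrite (gauge_ball gE).
have [C [T0 [C0 HC]]] := primitive_count_asymp gE.
set A := area _ in HC *.
have A0 : 0 <= A := gauge_area_ge0 E.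
have p2 : 0 < pi ^+ 2 :> R by rewrite exprn_gt0// pi_gt0.
set q := pi ^+ 2 in p2 HC *.
have Aq : 0 <= A / q by rewrite divr_ge0// ltW.
(* The second term pays for replacing (rho X)^2 by (ln X)^2 in 3 (A/q) T^2: since ln X - rho X <= ln
   2 <= 1, the two squares differ by at most 2 ln X. *)
exists (C + 6 * (A / q)) => [|]; first by lra.
(* Beyond this point ln X >= e, so ln (ln X) >= 1, and rho X >= ln X - 1 exceeds [T0]. *)
pose X0 : R := expR (expR 1 + `|T0| + 2).
near=> X.
have X0X : X0 <= X by near: X; apply: nbhs_pinfty_ge; rewrite num_real.
have e1 : 0 < expR (1 : R) by exact: expR_gt0.
have T00 := normr_ge0 T0.
have X3 : 2 < X.
  apply: lt_le_trans X0X; rewrite (lt_le_trans _ (expR_ge1Dx _))//; lra.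
have lX : expR 1 + `|T0| + 2 <= ln X.
  by rewrite -[leLHS]expRK ler_ln ?posrE ?expR_gt0//; lra.
have lX0 : 0 < ln X by lra.
have llX : 1 <= ln (ln X).
  by rewrite -[leLHS]expRK ler_ln ?posrE ?expR_gt0//; lra.
have ln2 : ln 2 <= 1 :> R.
  by have := @le_ln1Dx R 1; rewrite (_ : 1 + 1 = 2 :> R)//; apply; lra.
have /andP[t1 t2] := rho_bounds X3.
set T := rho X in t1 t2.
have T0T : T0 <= T by have := ler_norm T0; lra.
have Tp : 0 < T by lra.
have := HC T T0T.
rewrite (label_count_primitive label_range gE EE X3) natrM.
have TlnT : T * ln T <= ln X * ln (ln X).
  rewrite (@le_trans _ _ (T * ln (ln X)))//.
    by rewrite ler_pM2l// ler_ln ?posrE.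
  by rewrite ler_wpM2r//; lra.
have sq : 0 <= ln X ^+ 2 - T ^+ 2 <= 2 * (ln X * ln (ln X)).
  have -> : ln X ^+ 2 - T ^+ 2 = (ln X - T) * (ln X + T) by ring.
  apply/andP; split; first by rewrite mulr_ge0//; lra.
  rewrite (@le_trans _ _ (1 * (2 * ln X)))//; first by rewrite ler_pM//; lra.
  by rewrite mul1r ler_pM2l// ler_peMr//; lra.
move: (label_count F X)%:R (ln X ^+ 2) (T ^+ 2) sq => M L2 T2 /andP[sq0 sq1].
have -> : A * (6 / q) * T2 = 6 * (A / q) * T2 by ring.
have -> : 3 * A / q * L2 = 3 * (A / q) * L2 by ring.
move: (A / q) Aq (T * ln T) (ln X * ln (ln X)) TlnT sq1 => B B0 V W VW sq1.
have CV : C * V <= C * W by rewrite ler_pM2l.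
have W0 : 0 <= W by lra.
have CW0 : 0 <= C * W by rewrite mulr_ge0// ltW.
have BW : B * (L2 - T2) <= B * (2 * W) by rewrite ler_wpM2l.
have B1 : 0 <= B * (L2 - T2) by rewrite mulr_ge0.
rewrite mulrDl => /ler_normlP[h1 h2].
by apply/ler_normlP; split; lra.
Unshelve. all: by end_near.
Qed.
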